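(* The geometries $\Gamma_\mathbb{R}(\mathbb{H})$ and $\Gamma_\mathbb{C}(\mathbb{O})$ (the geometric supports of the two $\mathbb{O}\mathrm{P}^2$-geometries) are simply connected.
   Context: $\mathbb{H}$, $\mathbb{O}$ are the real quaternions and octonions, $\mathbb{C}\subset\mathbb{H}\subset\mathbb{O}$. For $(\mathbb{F},\mathbb{A})\in\{(\mathbb{R},\mathbb{H}),(\mathbb{C},\mathbb{O})\}$, $\mathbb{A},\mathbb{O}$ are right $\mathbb{F}$-vector spaces via right multiplication by $\mathbb{F}$. $(x|y)_\mathbb{R}=\mathrm{Re}(\bar xy)$; $(x|y)=(x|y)_\mathbb{R}$ if $\mathbb{F}=\mathbb{R}$, and for $\mathbb{F}=\mathbb{C}$, $(x|y)$ is the $\mathbb{C}$-component of $\bar xy$ in $\mathbb{O}=\mathbb{C}\oplus\mathbb{C}^{\perp}$. $\mathrm{Pu}_\mathbb{F}(\mathbb{B})$ is the real-orthogonal complement of $\mathbb{F}$ in $\mathbb{B}$. Sharp $\mathbb{F}$-morphisms $\mathbb{A}\to\mathbb{O}$: $\mathbb{F}$-linear multiplicative maps preserving $(\cdot|\cdot)$. $\Gamma_\mathbb{F}(\mathbb{A})$: points are 1-dim $\mathbb{F}$-subspaces $[x]$ of $\mathrm{Pu}_\mathbb{F}(\mathbb{A})$; lines are $[x,u]=\{(xt,ut):t\in\mathbb{F}^*\}$ with $x\in\mathrm{Pu}_\mathbb{F}(\mathbb{A})$, $u\in\mathrm{Pu}_\mathbb{F}(\mathbb{O})$, $|x|=|u|\ne0$;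 planes are sharp $\mathbb{F}$-morphisms $\phi:\mathbb{A}\to\mathbb{O}$; every point is incident with every plane, $[y]$ is incident with $[x,u]$ iff $(x|y)=0$, $[x,u]$ is incident with $\phi$ iff $\phi(x)=u$. It is a flat geometry of type $C_3$. A rank-3 geometry is simply connected if it admits no proper covering (covering = type-preserving morphism inducing isomorphisms on rank-2 residues), equivalently its flag complex has trivial fundamental group. *)

(* Defs.v *)
From Stdlib Require Import Reals List Relations.
Import ListNotations.
Set Implicit Arguments.
Open Scope R_scope.

(* ---------- Cayley–Dickson construction: C, H, O ---------- *)
(* (a,b)(c,d) = (ac - conj(d) b, d a + b conj(c)),  conj(a,b) = (conj a, -b) *)

Record Cx := mkC { c0 : R ; c1 : R }.
Definition C0 : Cx := mkC 0 0.
Definition Cadd (a b : Cx) : Cx := mkC (c0 a + c0 b) (c1 a + c1 b).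
Definition Copp (a : Cx) : Cx := mkC (- c0 a) (- c1 a).
Definition Csub (a b : Cx) : Cx := Cadd a (Copp b).
Definition Cconj (a : Cx) : Cx := mkC (c0 a) (- c1 a).
Definition Cmul (a b : Cx) : Cx :=
  mkC (c0 a * c0 b - c1 b * c1 a) (c1 b * c0 a + c1 a * c0 b).

Record Qt := mkQ { q0 : Cx ; q1 : Cx }.
Definition Q0 : Qt := mkQ C0 C0.
Definition Qadd (a b : Qt) : Qt := mkQ (Cadd (q0 a) (q0 b)) (Cadd (q1 a) (q1 b)).
Definition Qopp (a : Qt) : Qt := mkQ (Copp (q0 a)) (Copp (q1 a)).
Definition Qsub (a b : Qt) : Qt := Qadd a (Qopp b).
Definition Qconj (a : Qt) : Qt := mkQ (Cconj (q0 a)) (Copp (q1 a)).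
Definition Qmul (a b : Qt) : Qt :=
  mkQ (Csub (Cmul (q0 a) (q0 b)) (Cmul (Cconj (q1 b)) (q1 a)))
      (Cadd (Cmul (q1 b) (q0 a)) (Cmul (q1 a) (Cconj (q0 b)))).

Record Oc := mkO { o0 : Qt ; o1 : Qt }.
Definition O0 : Oc := mkO Q0 Q0.
Definition Oadd (a b : Oc) : Oc := mkO (Qadd (o0 a) (o0 b)) (Qadd (o1 a) (o1 b)).
Definition Oopp (a : Oc) : Oc := mkO (Qopp (o0 a)) (Qopp (o1 a)).
Definition Oconj (a : Oc) : Oc := mkO (Qconj (o0 a)) (Qopp (o1 a)).
Definition Omul (a b : Oc) : Oc :=
  mkO (Qsub (Qmul (o0 a) (o0 b)) (Qmul (Qconj (o1 b)) (o1 a)))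
      (Qadd (Qmul (o1 b) (o0 a)) (Qmul (o1 a) (Qconj (o0 b)))).

Definition ReO (x : Oc) : R := c0 (q0 (o0 x)).
Definition CpartO (x : Oc) : Cx := q0 (o0 x).           (* C-component in O = C ⊕ C^⊥ *)
Definition ofR (r : R) : Oc := mkO (mkQ (mkC r 0) C0) Q0.
Definition ofC (z : Cx) : Oc := mkO (mkQ z C0) Q0.

Definition rform (x y : Oc) : R := ReO (Omul (Oconj x) y).
Definition sqnorm (x : Oc) : R := rform x x.

(* ---------- the two cases (F,A) = (R,H) and (C,O) ---------- *)
Inductive fcase := RH | CO.

Definition inF (k : fcase) (t : Oc) : Prop :=
  match k with RH => t = ofR (ReO t) | CO => t = ofC (CpartO t) end.
Definition inA (k : fcase) (x : Oc) : Prop :=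
  match k with RH => o1 x = Q0 | CO => True end.
Definition projA (k : fcase) (x : Oc) : Oc :=
  match k with RH => mkO (o0 x) Q0 | CO => x end.
Definition form (k : fcase) (x y : Oc) : Oc :=
  match k with
  | RH => ofR (ReO (Omul (Oconj x) y))
  | CO => ofC (CpartO (Omul (Oconj x) y))
  end.
Definition inPu (k : fcase) (B : Oc -> Prop) (x : Oc) : Prop :=
  B x /\ forall t, inF k t -> rform t x = 0.

Definition is_sharp (k : fcase) (phi : Oc -> Oc) : Prop :=
  (forall x y, inA k x -> inA k y -> phi (Oadd x y) = Oadd (phi x) (phi y)) /\
  (forall x t, inA k x -> inF k t -> phi (Omul x t) = Omul (phi x) t) /\
  (forall x y, inA k x -> inA k y -> phi (Omul x y) = Omul (phi x) (phi y)) /\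
  (forall x y, inA k x -> inA k y -> form k (phi x) (phi y) = form k x y).

Definition pointset (k : fcase) (x : Oc) : Oc -> Prop :=
  fun y => exists t, inF k t /\ y = Omul x t.
Definition lineset (k : fcase) (x u : Oc) : Oc * Oc -> Prop :=
  fun p => exists t, inF k t /\ t <> O0 /\ p = (Omul x t, Omul u t).

Definition point (k : fcase) :=
  { P : Oc -> Prop | exists x, inPu k (inA k) x /\ x <> O0 /\ P = pointset k x }.
Definition line (k : fcase) :=
  { L : Oc * Oc -> Prop | exists x u,
      inPu k (inA k) x /\ inPu k (fun _ => True) u /\
      sqnorm x = sqnorm u /\ x <> O0 /\ L = lineset k x u }.
(* a map A -> O is represented by a map O -> O factoring through projA *)
Definition plane (k : fcase) :=
  { phi : Oc -> Oc | is_sharp k phi /\ forall x, phi x = phi (projA k x) }.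

Inductive gelt (k : fcase) :=
| Pt : point k -> gelt k
| Ln : line k -> gelt k
| Pl : plane k -> gelt k.

Definition gtyp (k : fcase) (a : gelt k) : nat :=
  match a with Pt _ => 0%nat | Ln _ => 1%nat | Pl _ => 2%nat end.

Definition inc_pt_ln (k : fcase) (P : point k) (L : line k) : Prop :=
  exists x u y, proj1_sig L = lineset k x u /\ proj1_sig P = pointset k y /\
                form k x y = O0.
Definition inc_ln_pl (k : fcase) (L : line k) (f : plane k) : Prop :=
  exists x u, proj1_sig L = lineset k x u /\ proj1_sig f x = u.

Definition ginc (k : fcase) (a b : gelt k) : Prop :=
  match a, b with
  | Pt P, Ln L | Ln L, Pt P => inc_pt_ln P L
  | Pt _, Pl _ | Pl _, Pt _ => True
  | Ln L, Pl f | Pl f, Ln L => inc_ln_pl L f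
  | _, _ => False
  end.

Record geometry := { elt : Type ; typ : elt -> nat ; inc : elt -> elt -> Prop }.

Definition Gamma (k : fcase) : geometry :=
  {| elt := gelt k ; typ := @gtyp k ; inc := @ginc k |}.

(* edges of the flag complex: incident elements of distinct types *)
Definition adj (G : geometry) (a b : elt G) : Prop :=
  typ G a <> typ G b /\ (inc G a b \/ inc G b a).

Inductive walk (G : geometry) : list (elt G) -> Prop :=
| walk1 a : walk G [a]
| walkS a b l : adj G a b -> walk G (b :: l) -> walk G (a :: b :: l).

(* elementary combinatorial homotopies (edge-path group of the flag complex):
   removing a backtrack, and shortcutting across a 2-simplex (a flag of size 3) *)
Inductive hstep (G : geometry) : list (elt G) -> list (elt G) -> Prop :=
| hback p q a b : adj G a b ->
    hstep G (p ++ a :: b :: a :: q) (p ++ a :: q)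
| htri p q a b c : adj G a b -> adj G b c -> adj G a c ->
    hstep G (p ++ a :: b :: c :: q) (p ++ a :: c :: q).

Definition homotopic (G : geometry) := clos_refl_sym_trans _ (hstep G).

Definition connected (G : geometry) : Prop :=
  forall a b : elt G, exists l, walk G (a :: l) /\ last (a :: l) a = b.

Definition simply_connected (G : geometry) : Prop :=
  connected G /\
  forall (a : elt G) (l : list (elt G)),
    walk G (a :: l) -> last (a :: l) a = a -> homotopic G (a :: l) [a].

(* Main.v *)
(** Every point is incident with every plane and every line lies on a point and on a plane, so all closed paths
    contract once the squares f - P - g - Q bound, and by composing squares one may take P and Q orthogonal.  Such
    a square bounds when f and g agree on the pole of PQ, the vector orthogonal to P and Q.

    Over R, the path P - f - Q thus depends only on the value of f at the pole of PQ.  Carrying a pair of planes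
    around an orthogonal triangle of points several times multiplies these values by imaginary units of O; as O is
    not associative, one chain of four multiplications fixes one value and moves another one, p, to any chosen unit
    orthogonal to p.

    Over C, the planes form the group SU(3), and each point P yields translations f - P - f h.  So one has
    homomorphisms i_P from SU(3) that agree for P and Q on the stabilizer of the pole of PQ, and must show that
    they are all equal.  For a unit x, let A be the common restriction to Stab(x) = SU(2) of the i_R with R
    orthogonal to x.  For every h in Stab(x), A(h) i_[x](h)^-1 commutes with the images of i_[x] and of A: if
    (x, y, z) is an eigenframe of h, conjugation by h preserves Stab(x), Stab(y) and Stab(z), on each of which two
    of i_[x], i_[y], i_[z] agree.  Hence A i_[x]^-1 is a homomorphism from
    SU(2) to an abelian group, and SU(2) is perfect, so A = i_[x].  Stabilizers of two orthogonal units generate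
    SU(3). *)

From Stdlib Require Import Reals Lra List Relations Setoid Morphisms.
From Stdlib Require Import Classical_Prop FunctionalExtensionality PropExtensionality ProofIrrelevance.
Require Import Defs.
Import ListNotations.
Set Implicit Arguments.
Unset Strict Implicit.
Open Scope R_scope.

(** * Edge-path calculus in a geometry *)

Section Homotopy.
Variable G : geometry.
Local Notation "l =~ m" := (homotopic G l m) (at level 70).

(** The elementary moves already carry a context on both sides, so enlarging it only reassociates
    lists. *)
Lemma homotopic_context p q l m : l =~ m -> p ++ l ++ q =~ p ++ m ++ q.
Proof.
  induction 1 as [l m H| | |]; [|apply rst_refl|now apply rst_sym|eapply rst_trans; eassumption].
  apply rst_step; destruct H as [p' q' a b H|p' q' a b c H1 H2 H3].
  - assert (E : forall r : list (elt G), p ++ (p' ++ r ++ q') ++ q = (p ++ p') ++ r ++ (q' ++ q))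
      by (intros; now rewrite !app_assoc).
    rewrite (E [a; b; a] : p ++ (p' ++ a :: b :: a :: q') ++ q = _), (E [a] : p ++ (p' ++ a :: q') ++ q = _).
    now apply hback.
  - assert (E : forall r : list (elt G), p ++ (p' ++ r ++ q') ++ q = (p ++ p') ++ r ++ (q' ++ q))
      by (intros; now rewrite !app_assoc).
    rewrite (E [a; b; c] : p ++ (p' ++ a :: b :: c :: q') ++ q = _), (E [a; c] : p ++ (p' ++ a :: c :: q') ++ q = _).
    now apply htri.
Qed.

#[global] Instance homotopic_equivalence : Equivalence (homotopic G).
Proof.
  split; [intros x; apply rst_refl|intros x y; apply rst_sym|intros x y z; apply rst_trans].
Qed.

#[global] Instance app_homotopic :
  Proper (homotopic G ==> homotopic G ==> homotopic G) (@app (elt G)).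
Proof.
  intros l l' H m m' H'; transitivity (l' ++ m).
  - exact (@homotopic_context [] m _ _ H).
  - rewrite <- (app_nil_r m), <- (app_nil_r m'); exact (@homotopic_context l' [] _ _ H').
Qed.

#[global] Instance cons_homotopic :
  Proper (eq ==> homotopic G ==> homotopic G) (@cons (elt G)).
Proof. intros a _ <- l m H; exact (@app_homotopic [a] [a] (rst_refl _ _ _) _ _ H). Qed.

Lemma homotopic_backtrack a b l : adj G a b -> a :: b :: a :: l =~ a :: l.
Proof. intros; apply rst_step; now apply (@hback G [] l). Qed.

Lemma homotopic_triangle a b c l :
  adj G a b -> adj G b c -> adj G a c -> a :: b :: c :: l =~ a :: c :: l.
Proof. intros; apply rst_step; now apply (@htri G [] l). Qed.

Lemma adj_sym a b : adj G a b -> adj G b a.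
Proof. intros [H H']; split; [now apply not_eq_sym|tauto]. Qed.

(** The path and its reverse cancel from the turning point outwards. [tl] drops the turning point,
    which joining the two vertex lists would repeat. *)
Lemma homotopic_rev_cancel a l : walk G (a :: l) -> (a :: l) ++ tl (rev (a :: l)) =~ [a].
Proof.
  revert a; induction l as [|b l IH]; intros a W; [reflexivity|].
  inversion W as [|? ? ? Hab Wb]; subst.
  assert (E : exists r, rev (b :: l) = r ++ [b]) by (exists (rev l); reflexivity).
  assert (E' : tl (rev (a :: b :: l)) = tl (rev (b :: l)) ++ [a]).
  { simpl; destruct (rev l ++ [b]) eqn:E1; [now destruct (rev l)|reflexivity]. }
  rewrite E'; change ((a :: b :: l) ++ tl (rev (b :: l)) ++ [a])
    with ([a] ++ (b :: l) ++ tl (rev (b :: l)) ++ [a]).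
  rewrite (app_assoc (b :: l)), (IH b Wb).
  now apply homotopic_backtrack.
Qed.
End Homotopy.

(** * Flat geometries in which all squares of points and planes bound *)

Lemma last_default (T : Type) (l : list T) a b c : last (a :: l) b = last (a :: l) c.
Proof.
  revert a; induction l as [|d l IH]; intros a; [reflexivity|exact (IH d)].
Qed.

Section Flat.
Variable k : fcase.
Local Notation G := (Gamma k).

(** [homotopic] over [gelt k] instead of [elt (Gamma k)], so that setoid rewriting meets the types
    in which the paths below are written. *)
Definition path_eq : relation (list (gelt k)) := homotopic G.
Local Notation "l =~ m" := (path_eq l m) (at level 70).

#[global] Instance path_eq_equivalence : Equivalence path_eq := @homotopic_equivalence G.
#[global] Instance app_path_eq :
  Proper (path_eq ==> path_eq ==> path_eq) (@app (gelt k)) := @app_homotopic G.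
#[global] Instance cons_path_eq :
  Proper (eq ==> path_eq ==> path_eq) (@cons (gelt k)) := @cons_homotopic G.

Lemma backtrack a b l : adj G a b -> a :: b :: a :: l =~ a :: l.
Proof. exact (@homotopic_backtrack G a b l). Qed.

Lemma triangle a b c l :
  adj G a b -> adj G b c -> adj G a c -> a :: b :: c :: l =~ a :: c :: l.
Proof. exact (@homotopic_triangle G a b c l). Qed.

(** Flatness makes both lists paths for every choice of points and planes; the relation says that
    the closed path f - P - g - Q - f bounds. *)
Definition square (P Q : point k) (f g : plane k) : Prop :=
  [Pl f; Pt P; Pl g] =~ [Pl f; Pt Q; Pl g].

Lemma adj_pt_pl (P : point k) (f : plane k) : adj G (Pt P) (Pl f).
Proof. split; [discriminate|left; exact I]. Qed.

Lemma adj_pl_pt (P : point k) (f : plane k) : adj G (Pl f) (Pt P).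
Proof. split; [discriminate|left; exact I]. Qed.

Lemma square_sym P Q f g : square P Q f g -> square Q P f g.
Proof. unfold square; now symmetry. Qed.

Lemma square_trans P Q S f g : square P Q f g -> square Q S f g -> square P S f g.
Proof. unfold square; intros; etransitivity; eassumption. Qed.

Lemma square_cons P Q f g l : square P Q f g -> Pl f :: Pt P :: Pl g :: l =~ Pl f :: Pt Q :: Pl g :: l.
Proof.
  intros H; exact (app_path_eq H (reflexivity l)).
Qed.

(** A square may be cut at its points as well as at its planes: insert the backtrack Q - g - Q,
    cross the square, cancel P - f - P. *)
Lemma square_flip P Q f g l : square P Q f g ->
  Pt P :: Pl f :: Pt Q :: l =~ Pt P :: Pl g :: Pt Q :: l.
Proof.
  intros H.
  rewrite <- (@backtrack (Pt Q) (Pl g) l (adj_pt_pl _ _)) at 1.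
  rewrite <- (square_cons (Pt Q :: l) H).
  now rewrite (@backtrack (Pt P) (Pl f) _ (adj_pt_pl _ _)).
Qed.

Lemma square_of_flip P Q f g :
  Pt P :: Pl f :: [Pt Q] =~ Pt P :: Pl g :: [Pt Q] -> square P Q f g.
Proof.
  intros H; unfold square.
  rewrite <- (@backtrack (Pl g) (Pt Q) [] (adj_pl_pt _ _)) at 1.
  change (Pl f :: [Pt P; Pl g; Pt Q] ++ [Pl g] =~ [Pl f; Pt Q; Pl g]).
  rewrite <- H; cbn [app].
  now rewrite (@backtrack (Pl f) (Pt P) _ (adj_pl_pt _ _)).
Qed.

Lemma square_trans_planes P Q f g h : square P Q f g -> square P Q g h -> square P Q f h.
Proof.
  intros H H'; apply square_of_flip.
  now rewrite (square_flip [] H), (square_flip [] H').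
Qed.

Lemma loop_middle f g P Q S l : square P Q f g ->
  Pt S :: Pl f :: Pt P :: Pl g :: l =~ Pt S :: Pl f :: Pt Q :: Pl g :: l.
Proof. intros H; now rewrite (square_cons l H). Qed.

Lemma loop_sides f g f' g' P S : square S P f f' -> square S P g g' ->
  [Pt S; Pl f; Pt P; Pl g; Pt S] =~ [Pt S; Pl f'; Pt P; Pl g'; Pt S].
Proof.
  intros H H'; rewrite (square_flip [Pl g; Pt S] H).
  now rewrite (square_flip [] (square_sym H')).
Qed.

(** Follow the loop P3 - f1 - P1 - g1 - P3. The squares on [P1], [P2] switch its middle point, and
    those through [P3] replace both of its planes at once, until it becomes P3 - f4 - P1 - g4 - P3.
    As the halves through [f1] and [f4] are homotopic, so are the halves through [g1] and [g4]. *)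
Lemma square_by_loops P1 P2 P3 f1 f2 f3 f4 g1 g2 g3 g4 :
  square P1 P2 f1 g1 -> square P1 P2 f2 g2 -> square P1 P2 f3 g3 -> square P1 P2 f4 g4 ->
  square P3 P2 f1 f2 -> square P3 P2 g1 g2 ->
  square P3 P1 f2 f3 -> square P3 P1 g2 g3 ->
  square P3 P2 f3 f4 -> square P3 P2 g3 g4 ->
  square P3 P1 f1 f4 -> square P1 P3 g1 g4.
Proof.
  intros S1 S2 S3 S4 Hf1 Hg1 Hf2 Hg2 Hf3 Hg3 Hf.
  assert (E : [Pt P3; Pl f1; Pt P1; Pl g1; Pt P3] =~ [Pt P3; Pl f4; Pt P1; Pl g4; Pt P3]).
  { rewrite (loop_middle P3 [Pt P3] S1), (loop_sides Hf1 Hg1).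
    rewrite <- (loop_middle P3 [Pt P3] S2), (loop_sides Hf2 Hg2).
    rewrite (loop_middle P3 [Pt P3] S3), (loop_sides Hf3 Hg3).
    now rewrite <- (loop_middle P3 [Pt P3] S4). }
  rewrite (square_flip [Pl g1; Pt P3] Hf) in E.
  apply square_of_flip.
  rewrite <- (@backtrack (Pt P1) (Pl f4) [Pl g1; Pt P3] (adj_pt_pl _ _)).
  rewrite <- (@backtrack (Pl f4) (Pt P3) (Pt P1 :: _) (adj_pl_pt _ _)).
  rewrite E.
  now rewrite (@backtrack (Pl f4) (Pt P3)), (@backtrack (Pt P1) (Pl f4)) by auto using adj_pt_pl, adj_pl_pt.
Qed.

Hypothesis all_squares : forall P Q f g, square P Q f g.
Hypothesis line_pt : forall L : line k, exists P, adj G (Ln L) (Pt P).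
Hypothesis line_pl : forall L : line k, exists f, adj G (Ln L) (Pl f).
Variables (P0 : point k) (f0 : plane k).

(** Standard paths to the base plane [f0], listed without their start. This is a relation because a
    line may use any of its points. *)
Inductive canonical : gelt k -> list (gelt k) -> Prop :=
| canonical_pt P : canonical (Pt P) [Pl f0]
| canonical_pl f : canonical (Pl f) [Pt P0; Pl f0]
| canonical_ln L P : adj G (Ln L) (Pt P) -> canonical (Ln L) [Pt P; Pl f0].

Lemma canonical_exists a : exists l, canonical a l.
Proof.
  destruct a as [P|L|f]; [eexists; constructor| |eexists; constructor].
  destruct (line_pt L) as [P H]; eexists; econstructor; exact H.
Qed.

Lemma canonical_walk a l : canonical a l -> walk G (a :: l).
Proof.
  destruct 1; repeat apply (@walkS G); try apply (@walk1 G); auto using adj_pt_pl, adj_pl_pt.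
Qed.

(** Both paths can be routed through a plane [f] on [L], as [L], [f] and either point form a flag;
    the square f - P - f0 - Q remains. *)
Lemma line_through_point L P Q : adj G (Ln L) (Pt P) -> adj G (Ln L) (Pt Q) ->
  [Ln L; Pt P; Pl f0] =~ [Ln L; Pt Q; Pl f0].
Proof.
  intros HP HQ; destruct (line_pl L) as [f Hf].
  rewrite <- (@triangle (Ln L) (Pl f) (Pt P) [Pl f0]) by auto using adj_pl_pt.
  rewrite <- (@triangle (Ln L) (Pl f) (Pt Q) [Pl f0]) by auto using adj_pl_pt.
  now rewrite (square_cons [] (all_squares P Q f f0)).
Qed.

(** An edge and the standard paths from its two ends form a contractible cycle, so standard paths
    absorb a walk edge by edge. *)
Lemma canonical_step a b l m : adj G a b -> canonical a l -> canonical b m -> a :: b :: m =~ a :: l.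
Proof.
  intros Hab Ha Hb.
  destruct Ha as [P|f|L P HP]; destruct Hb as [Q|g|M Q HQ];
    try (exfalso; apply (proj1 Hab); reflexivity).
  - rewrite (square_cons [] (all_squares P0 P g f0)).
    now apply backtrack.
  - rewrite (line_through_point HQ (adj_sym Hab)).
    now apply backtrack.
  - apply (square_cons [] (all_squares Q P0 f f0)).
  - rewrite triangle by auto using adj_pl_pt, adj_sym.
    apply (square_cons [] (all_squares Q P0 f f0)).
  - now apply line_through_point.
  - rewrite (square_cons [] (all_squares P0 P g f0)).
    apply triangle; auto using adj_pl_pt.
Qed.

Lemma canonical_walk_end a l m n : walk G (a :: l) ->
  canonical a m -> canonical (last (a :: l) a) n -> (a :: l) ++ n =~ a :: m.
Proof.
  revert a m; induction l as [|b l IH]; intros a m W Ha He.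
  - simpl in *. destruct Ha; inversion He; subst; try reflexivity.
    now apply line_through_point.
  - inversion W as [|? ? ? Hab Wb]; subst.
    destruct (canonical_exists b) as [mb Hb].
    change (a :: (b :: l) ++ n =~ a :: m).
    rewrite (IH b mb Wb Hb).
    + apply canonical_step; assumption.
    + now rewrite (last_default l b b a).
Qed.

Definition reachable (a b : gelt k) : Prop := exists l, walk G (a :: l) /\ last (a :: l) a = b.

Lemma reachable_refl a : reachable a a.
Proof. exists []; split; [apply (@walk1 G)|reflexivity]. Qed.

Lemma reachable_step a b c : adj G a b -> reachable b c -> reachable a c.
Proof.
  intros H [l [W E]]; exists (b :: l); split; [now apply (@walkS G)|].
  rewrite <- E; exact (last_default l b a b).
Qed.

Lemma reachable_from_plane f b : reachable (Pl f) b.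
Proof.
  destruct b as [P|L|g].
  - apply reachable_step with (Pt P); [apply adj_pl_pt|apply reachable_refl].
  - destruct (line_pt L) as [P H].
    apply reachable_step with (Pt P); [apply adj_pl_pt|].
    apply reachable_step with (Ln L); [apply adj_sym, H|apply reachable_refl].
  - apply reachable_step with (Pt P0); [apply adj_pl_pt|].
    apply reachable_step with (Pl g); [apply adj_pt_pl|apply reachable_refl].
Qed.

Lemma flat_simply_connected : simply_connected G.
Proof.
  split.
  - intros a b; change (reachable a b); destruct a as [P|L|f].
    + apply reachable_step with (Pl f0); [apply adj_pt_pl|apply reachable_from_plane].
    + destruct (line_pl L) as [f H]; apply reachable_step with (Pl f); [exact H|].
      apply reachable_from_plane.
    + apply reachable_from_plane.
  - intros a l W He.
    destruct (canonical_exists a) as [m Hm].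
    assert (H : (a :: l) ++ m =~ a :: m) by (apply canonical_walk_end; [..|rewrite He]; assumption).
    pose proof (homotopic_rev_cancel (canonical_walk Hm)) as C.
    change (path_eq (a :: l) [a]).
    (* Insert at the end of the loop the standard path from [a] and its way back; the first absorbs
       the loop, and then the two cancel. *)
    transitivity ((a :: l) ++ tl (a :: m) ++ tl (rev (a :: m))).
    + rewrite (@app_removelast_last _ (a :: l) a) by discriminate.
      rewrite He, <- app_assoc; apply app_path_eq; [reflexivity|symmetry; exact C].
    + cbn [tl]; rewrite app_assoc, H. exact C.
Qed.
End Flat.

(** * Octonion identities *)

Definition C1 : Cx := mkC 1 0.

Lemma Cx_ring_theory : ring_theory C0 C1 Cadd Cmul Csub Copp eq.
Proof.
  split; intros;
    repeat match goal with x : Cx |- _ => let u := fresh "u" in let v := fresh "u" in destruct x as [u v] end;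
    cbv [Cadd Cmul Csub Copp C0 C1 c0 c1]; f_equal; ring.
Qed.
Add Ring Cx_ring : Cx_ring_theory.

Lemma Cconj_add a b : Cconj (Cadd a b) = Cadd (Cconj a) (Cconj b).
Proof. cbv [Cconj Cadd c0 c1]; f_equal; ring. Qed.
Lemma Cconj_opp a : Cconj (Copp a) = Copp (Cconj a).
Proof. reflexivity. Qed.
Lemma Cconj_sub a b : Cconj (Csub a b) = Csub (Cconj a) (Cconj b).
Proof. unfold Csub; now rewrite Cconj_add, Cconj_opp. Qed.
Lemma Cconj_mul a b : Cconj (Cmul a b) = Cmul (Cconj a) (Cconj b).
Proof. cbv [Cconj Cmul c0 c1]; f_equal; ring. Qed.
Lemma Cconj_involutive a : Cconj (Cconj a) = a.
Proof. destruct a as [u v]; cbv [Cconj c0 c1]; f_equal; ring. Qed.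
Lemma Cconj_0 : Cconj C0 = C0.
Proof. cbv [Cconj C0 c0 c1]; f_equal; ring. Qed.
Lemma Cconj_1 : Cconj C1 = C1.
Proof. cbv [Cconj C1 c0 c1]; f_equal; ring. Qed.

(** The form of the case [CO] with values in [Cx], where [ring] applies. *)
Definition herm (x y : Oc) : Cx := CpartO (Omul (Oconj x) y).
Definition O1 : Oc := ofR 1.

Ltac destruct_oct :=
  repeat match goal with
  | x : Oc |- _ => let u := fresh "u" in let v := fresh "u" in destruct x as [u v]
  | x : Qt |- _ => let u := fresh "u" in let v := fresh "u" in destruct x as [u v]
  | x : Cx |- _ => let u := fresh "u" in let v := fresh "u" in destruct x as [u v]
  end.
Ltac unfold_oct :=
  cbv [Omul Oadd Oopp Oconj O0 O1 ofR ofC ReO CpartO rform herm sqnorm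
       Qmul Qadd Qopp Qsub Qconj Q0 Cmul Cadd Copp Csub Cconj C0 C1
       o0 o1 q0 q1 c0 c1] in *.
Ltac split_eq :=
  repeat match goal with
  | |- mkO _ _ = mkO _ _ => apply f_equal2
  | |- mkQ _ _ = mkQ _ _ => apply f_equal2
  | |- mkC _ _ = mkC _ _ => apply f_equal2
  end.
Ltac oct := intros; destruct_oct; unfold_oct; subst; split_eq; ring.

(** A variant of [oct] that keeps the four complex coordinates as atoms and pushes conjugation down
    to them. *)
Ltac unfold_octC :=
  cbv [Omul Oadd Oopp Oconj O0 O1 ofC CpartO herm
       Qmul Qadd Qopp Qsub Qconj Q0 o0 o1 q0 q1] in *.
Ltac push_conj :=
  repeat rewrite ?Cconj_add, ?Cconj_opp, ?Cconj_sub, ?Cconj_mul, ?Cconj_involutive,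
    ?Cconj_0, ?Cconj_1.
Ltac octC :=
  intros;
  repeat match goal with
  | x : Oc |- _ => let u := fresh "u" in let v := fresh "u" in destruct x as [u v]
  | x : Qt |- _ => let u := fresh "u" in let v := fresh "u" in destruct x as [u v]
  end;
  unfold_octC; subst; push_conj; split_eq; ring.

Section Identities.
Implicit Types a b x y z : Oc.

Lemma Omul_add_l x y z : Omul (Oadd x y) z = Oadd (Omul x z) (Omul y z). Proof. oct. Qed.
Lemma Omul_add_r x y z : Omul x (Oadd y z) = Oadd (Omul x y) (Omul x z). Proof. oct. Qed.
Lemma Omul_opp_l x y : Omul (Oopp x) y = Oopp (Omul x y). Proof. oct. Qed.
Lemma Omul_opp_r x y : Omul x (Oopp y) = Oopp (Omul x y). Proof. oct. Qed.
Lemma Oopp_involutive x : Oopp (Oopp x) = x. Proof. oct. Qed.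
Lemma Omul_1_r x : Omul x O1 = x. Proof. oct. Qed.
Lemma Omul_1_l x : Omul O1 x = x. Proof. oct. Qed.

Lemma rform_sym x y : rform x y = rform y x. Proof. oct. Qed.
Lemma rform_add_l x y z : rform (Oadd x y) z = rform x z + rform y z. Proof. oct. Qed.
Lemma rform_add_r x y z : rform x (Oadd y z) = rform x y + rform x z. Proof. oct. Qed.
Lemma rform_opp_l x y : rform (Oopp x) y = - rform x y. Proof. oct. Qed.
Lemma rform_opp_r x y : rform x (Oopp y) = - rform x y. Proof. oct. Qed.
Lemma rform_scale_l r x y : rform (Omul x (ofR r)) y = r * rform x y. Proof. oct. Qed.
Lemma rform_scale_r r x y : rform x (Omul y (ofR r)) = r * rform x y. Proof. oct. Qed.
Lemma rform_1_l x : rform O1 x = ReO x. Proof. oct. Qed.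

Lemma sqnorm_mul x y : sqnorm (Omul x y) = sqnorm x * sqnorm y. Proof. oct. Qed.

Lemma left_skew a x y : ReO a = 0 -> rform (Omul a x) y = - rform x (Omul a y). Proof. oct. Qed.
Lemma right_skew a x y : ReO a = 0 -> rform (Omul x a) y = - rform x (Omul y a). Proof. oct. Qed.

(** The polarized alternative law: multiplications by imaginary octonions satisfy the Clifford
    relations, which replace associativity below. *)
Lemma left_clifford a b x : ReO a = 0 -> ReO b = 0 ->
  Omul a (Omul b x) = Oadd (Oopp (Omul b (Omul a x))) (Omul x (ofR (- 2 * rform a b))).
Proof. oct. Qed.
Lemma right_clifford a b x : ReO a = 0 -> ReO b = 0 ->
  Omul (Omul x a) b = Oadd (Oopp (Omul (Omul x b) a)) (Omul x (ofR (- 2 * rform a b))).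
Proof. oct. Qed.
Lemma left_square a x : ReO a = 0 -> Omul a (Omul a x) = Omul x (ofR (- sqnorm a)).
Proof. oct. Qed.
Lemma right_square a x : ReO a = 0 -> Omul (Omul x a) a = Omul x (ofR (- sqnorm a)).
Proof. oct. Qed.
Lemma square_imag a : ReO a = 0 -> Omul a a = ofR (- sqnorm a).
Proof. oct. Qed.
Lemma anticommute a b : ReO a = 0 -> ReO b = 0 ->
  Omul a b = Oadd (Oopp (Omul b a)) (ofR (- 2 * rform a b)).
Proof. oct. Qed.
Lemma Re_mul_imag a b : ReO a = 0 -> ReO (Omul a b) = - rform a b.
Proof. oct. Qed.
End Identities.

(** * Quaternion subalgebras spanned by two orthonormal imaginary units *)

Definition rcomb (a b g : Oc) (t x y z : R) : Oc :=
  Oadd (ofR t) (Oadd (Omul a (ofR x)) (Oadd (Omul b (ofR y)) (Omul g (ofR z)))).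

Record rframe (a b : Oc) : Prop := {
  rframe_im1 : ReO a = 0; rframe_im2 : ReO b = 0;
  rframe_unit1 : sqnorm a = 1; rframe_unit2 : sqnorm b = 1;
  rframe_orth : rform a b = 0 }.

Lemma rcomb_mul_expand a b g t x y z t' x' y' z' :
  Omul (rcomb a b g t x y z) (rcomb a b g t' x' y' z') =
  Oadd (rcomb a b g (t * t') (t * x' + x * t') (t * y' + y * t') (t * z' + z * t'))
  (Oadd (Oadd (Omul (Omul a a) (ofR (x * x'))) (Oadd (Omul (Omul b b) (ofR (y * y'))) (Omul (Omul g g) (ofR (z * z')))))
  (Oadd (Oadd (Omul (Omul a b) (ofR (x * y'))) (Omul (Omul b a) (ofR (y * x'))))
  (Oadd (Oadd (Omul (Omul a g) (ofR (x * z'))) (Omul (Omul g a) (ofR (z * x'))))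
        (Oadd (Omul (Omul b g) (ofR (y * z'))) (Omul (Omul g b) (ofR (z * y'))))))).
Proof. unfold rcomb. oct. Qed.

Lemma Omul_minus_1 x : Omul x (ofR (-1)) = Oopp x.
Proof. oct. Qed.

Lemma Oadd_null_scale x y : Oadd x (Omul y (ofR (-2 * 0))) = x.
Proof. oct. Qed.

Lemma Oadd_null_real x : Oadd x (ofR (-2 * 0)) = x.
Proof. oct. Qed.

Lemma left_unit_square a x : ReO a = 0 -> sqnorm a = 1 -> Omul a (Omul a x) = Oopp x.
Proof. intros H H'; rewrite (left_square _ H), H'; apply Omul_minus_1. Qed.
Lemma right_unit_square a x : ReO a = 0 -> sqnorm a = 1 -> Omul (Omul x a) a = Oopp x.
Proof. intros H H'; rewrite (right_square _ H), H'; apply Omul_minus_1. Qed.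
Lemma left_anticommute a b x : ReO a = 0 -> ReO b = 0 -> rform a b = 0 ->
  Omul a (Omul b x) = Oopp (Omul b (Omul a x)).
Proof. intros Ha Hb H; rewrite (left_clifford x Ha Hb), H; apply Oadd_null_scale. Qed.
Lemma right_anticommute a b x : ReO a = 0 -> ReO b = 0 -> rform a b = 0 ->
  Omul (Omul x a) b = Oopp (Omul (Omul x b) a).
Proof. intros Ha Hb H; rewrite (right_clifford x Ha Hb), H; apply Oadd_null_scale. Qed.
Lemma anticommute_orth a b : ReO a = 0 -> ReO b = 0 -> rform a b = 0 ->
  Omul a b = Oopp (Omul b a).
Proof. intros Ha Hb H; rewrite (anticommute Ha Hb), H; apply Oadd_null_real. Qed.

Lemma rframe_sym a b : rframe a b -> rframe b a.
Proof. intros []; split; auto; now rewrite rform_sym. Qed.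

Lemma rframe_next a b : rframe a b -> rframe b (Omul a b).
Proof.
  intros [Ha Hb Na Nb H]; split; auto.
  - rewrite Re_mul_imag, H by assumption; ring.
  - rewrite sqnorm_mul, Na, Nb; ring.
  - rewrite rform_sym, (right_skew _ _ Hb), (square_imag Hb), Nb.
    rewrite <- (Omul_1_l (ofR _)), rform_scale_r, rform_sym, rform_1_l, Ha; ring.
Qed.

Lemma rframe_mul_next a b : rframe a b -> Omul b (Omul a b) = a.
Proof.
  intros [Ha Hb Na Nb H].
  rewrite (anticommute_orth Ha Hb H), Omul_opp_r, left_unit_square by assumption.
  apply Oopp_involutive.
Qed.

Lemma rframe_anticommute a b : rframe a b -> Omul b a = Oopp (Omul a b).
Proof. intros []; apply anticommute_orth; auto; now rewrite rform_sym. Qed.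

Lemma rframe_square a b : rframe a b -> Omul a a = ofR (-1).
Proof. intros [Ha _ Na _ _]; now rewrite (square_imag Ha), Na. Qed.

(** [a], [b] and ab obey the multiplication table of i, j, k, by applying [rframe_mul_next]
    cyclically; this is Hamilton's product formula. *)
Lemma rcomb_mul a b t x y z t' x' y' z' : rframe a b ->
  Omul (rcomb a b (Omul a b) t x y z) (rcomb a b (Omul a b) t' x' y' z') =
  rcomb a b (Omul a b) (t * t' - x * x' - y * y' - z * z')
    (t * x' + x * t' + y * z' - z * y') (t * y' + y * t' + z * x' - x * z')
    (t * z' + z * t' + x * y' - y * x').
Proof.
  intros F; pose proof (rframe_next F) as F1; pose proof (rframe_next F1) as F2.
  rewrite rcomb_mul_expand.
  rewrite (rframe_square F), (rframe_square F1), (rframe_square F2), (rframe_anticommute F).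
  pose proof (rframe_mul_next F) as E; rewrite E in F2.
  assert (E2 : Omul (Omul a b) a = b) by (rewrite <- E at 2; apply rframe_mul_next, F1).
  assert (E3 := rframe_anticommute F1); assert (E4 := rframe_anticommute F2).
  rewrite E in E3; rewrite E2 in E4; rewrite E, E2, E3, E4.
  generalize (Omul a b); unfold rcomb; intros g; clear.
  oct.
Qed.

Lemma rcomb_add a b g t x y z t' x' y' z' :
  Oadd (rcomb a b g t x y z) (rcomb a b g t' x' y' z') =
  rcomb a b g (t + t') (x + x') (y + y') (z + z').
Proof. unfold rcomb; oct. Qed.

Lemma rcomb_scale a b g t x y z r :
  Omul (rcomb a b g t x y z) (ofR r) = rcomb a b g (t * r) (x * r) (y * r) (z * r).
Proof. unfold rcomb; oct. Qed.

Lemma rform_rcomb_l a b g t x y z u :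
  rform (rcomb a b g t x y z) u = t * ReO u + x * rform a u + y * rform b u + z * rform g u.
Proof.
  unfold rcomb; rewrite !rform_add_l, !rform_scale_l.
  rewrite <- (Omul_1_l (ofR t)), rform_scale_l, rform_1_l; ring.
Qed.

Lemma rcomb_coordinates a b t x y z : rframe a b ->
  let u := rcomb a b (Omul a b) t x y z in
  ReO u = t /\ rform a u = x /\ rform b u = y /\ rform (Omul a b) u = z.
Proof.
  intros F u; subst u; pose proof (rframe_next F) as F1; pose proof (rframe_next F1) as F2.
  rewrite (rframe_mul_next F) in F2.
  rewrite <- rform_1_l, !(rform_sym _ (rcomb _ _ _ _ _ _ _)), !rform_rcomb_l.
  rewrite !(rform_sym _ O1), !rform_1_l.
  destruct F as [Ha Hb Na Nb H], F1 as [_ Hc _ Nc H1], F2 as [_ _ _ _ H2].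
  change (rform a a) with (sqnorm a); change (rform b b) with (sqnorm b).
  change (rform (Omul a b) (Omul a b)) with (sqnorm (Omul a b)).
  rewrite (rform_sym b a), (rform_sym a (Omul a b)), (rform_sym (Omul a b) b).
  rewrite Ha, Hb, Hc, Na, Nb, Nc, H, H1, H2; change (ReO O1) with 1.
  repeat split; ring.
Qed.

(* Cramer's rule for the Gram matrix of a and b; ab + (a|b) is their cross product. *)
Lemma quaternion_gram a b y : o1 a = Q0 -> o1 b = Q0 -> o1 y = Q0 -> ReO a = 0 -> ReO b = 0 ->
  Omul y (ofR (sqnorm a * sqnorm b - rform a b * rform a b)) =
  rcomb a b (Oadd (Omul a b) (ofR (rform a b)))
    (ReO y * (sqnorm a * sqnorm b - rform a b * rform a b))
    (sqnorm b * rform a y - rform a b * rform b y)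
    (sqnorm a * rform b y - rform a b * rform a y)
    (rform (Oadd (Omul a b) (ofR (rform a b))) y).
Proof. 
  destruct a as [a a'], b as [b b'], y as [y y']; cbn [o1]; intros -> -> ->; unfold rcomb; oct.
Qed.

(** The Gram determinant of an orthonormal pair is 1, so Cramer's rule gives the coordinates. *)
Lemma quaternion_complete a b y : rframe a b -> o1 a = Q0 -> o1 b = Q0 -> o1 y = Q0 ->
  y = rcomb a b (Omul a b) (ReO y) (rform a y) (rform b y) (rform (Omul a b) y).
Proof.
  intros [Ha Hb Na Nb H] Qa Qb Qy; pose proof (quaternion_gram Qa Qb Qy Ha Hb) as E.
  rewrite H, Na, Nb in E.
  replace (Oadd (Omul a b) (ofR 0)) with (Omul a b) in E by (clear; oct).
  replace (1 * 1 - 0 * 0) with 1 in E by ring.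
  change (ofR 1) with O1 in E; rewrite Omul_1_r in E; rewrite E at 1; f_equal; ring.
Qed.

(** * Points, lines and sharp morphisms *)

Lemma Oc_sum_squares x : sqnorm x =
  c0 (q0 (o0 x)) * c0 (q0 (o0 x)) + c1 (q0 (o0 x)) * c1 (q0 (o0 x)) +
  (c0 (q1 (o0 x)) * c0 (q1 (o0 x)) + c1 (q1 (o0 x)) * c1 (q1 (o0 x))) +
  (c0 (q0 (o1 x)) * c0 (q0 (o1 x)) + c1 (q0 (o1 x)) * c1 (q0 (o1 x))) +
  (c0 (q1 (o1 x)) * c0 (q1 (o1 x)) + c1 (q1 (o1 x)) * c1 (q1 (o1 x))).
Proof. destruct_oct; unfold_oct; ring. Qed.

Lemma sqnorm_nonneg x : 0 <= sqnorm x.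
Proof.
  rewrite Oc_sum_squares.
  repeat apply Rplus_le_le_0_compat; apply Rle_0_sqr.
Qed.

Lemma sqnorm_eq0 x : sqnorm x = 0 -> x = O0.
Proof.
  rewrite Oc_sum_squares; destruct x as [[[a b] [c d]] [[e f] [g h]]]; cbn [o0 o1 q0 q1 c0 c1].
  intros H.
  assert (S : forall r, 0 <= r * r) by (intros; apply Rle_0_sqr).
  assert (Z : forall r, r * r <= 0 -> r = 0).
  { intros r Hr; apply Rsqr_0_uniq; unfold Rsqr; specialize (S r); lra. }
  pose proof (S a); pose proof (S b); pose proof (S c); pose proof (S d).
  pose proof (S e); pose proof (S f); pose proof (S g); pose proof (S h).
  now rewrite (Z a), (Z b), (Z c), (Z d), (Z e), (Z f), (Z g), (Z h) by lra.
Qed.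

Lemma sqnorm_pos x : x <> O0 -> 0 < sqnorm x.
Proof.
  intros H; destruct (sqnorm_nonneg x) as [L|E]; [exact L|].
  now contradiction H; apply sqnorm_eq0.
Qed.

Lemma sqnorm_1_neq0 x : sqnorm x = 1 -> x <> O0.
Proof.
  intros H ->; replace (sqnorm O0) with 0 in H by oct; lra.
Qed.

Lemma Omul_ofR x r s : Omul (Omul x (ofR r)) (ofR s) = Omul x (ofR (r * s)).
Proof. oct. Qed.

Lemma sqnorm_scale x r : sqnorm (Omul x (ofR r)) = sqnorm x * (r * r).
Proof. oct. Qed.

Lemma normalize x : x <> O0 -> exists r, r <> 0 /\ sqnorm (Omul x (ofR r)) = 1.
Proof.
  intros H; pose proof (sqnorm_pos H) as P; pose proof (sqrt_lt_R0 _ P) as S.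
  exists (/ sqrt (sqnorm x)); split; [apply Rinv_neq_0_compat; lra|].
  rewrite sqnorm_scale; rewrite <- (sqrt_sqrt (sqnorm x)) at 1 by lra; field; lra.
Qed.

Section Generic.
Variable k : fcase.
Implicit Types (P Q : point k) (f g : plane k).

Definition fn (f : plane k) : Oc -> Oc := proj1_sig f.

Lemma inF_ofR r : inF k (ofR r).
Proof. destruct k; reflexivity. Qed.

Lemma inF_inA t : inF k t -> inA k t.
Proof. destruct k; cbn; [intros ->; reflexivity|trivial]. Qed.

Lemma inA_O1 : inA k O1.
Proof. apply inF_inA, inF_ofR. Qed.

Lemma rform_form x y : rform x y = ReO (form k x y).
Proof. destruct k; reflexivity. Qed.

Lemma form_linear x y t : inF k t -> form k x (Omul y t) = Omul (form k x y) t.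
Proof. destruct k; cbn [form inF]; intros ->; oct. Qed.

Lemma form_add x y z : form k x (Oadd y z) = Oadd (form k x y) (form k x z).
Proof. destruct k; cbn [form]; oct. Qed.

Lemma form_0_r x : form k x O0 = O0.
Proof. destruct k; cbn [form]; oct. Qed.

Lemma form_opp x y : form k x (Oopp y) = Oopp (form k x y).
Proof. destruct k; cbn [form]; oct. Qed.

Lemma form_conj x y : form k y x = Oconj (form k x y).
Proof. destruct k; cbn [form]; oct. Qed.

Lemma form_sym0 x y : form k x y = O0 -> form k y x = O0.
Proof. intros H; rewrite form_conj, H; oct. Qed.

Lemma inF_form x y : inF k (form k x y).
Proof. destruct k; reflexivity. Qed.

Lemma form_self x : form k x x = ofR (sqnorm x).
Proof. destruct k; cbn [form]; oct. Qed.

Lemma Omul_F_assoc x s t : inF k s -> inF k t -> Omul (Omul x s) t = Omul x (Omul s t).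
Proof. destruct k; cbn [inF]; intros -> ->; oct. Qed.

(** The two algebras in which frames are needed: the source A and the target O of the sharp
    morphisms. *)
Definition dom_ok (D : Oc -> Prop) : Prop := D = inA k \/ D = (fun _ => True).

Lemma dom_scale D x t : dom_ok D -> inF k t -> D x -> D (Omul x t).
Proof.
  intros [-> | ->] Ht; [|trivial]; destruct k; cbn [inA inF] in *; [|trivial].
  rewrite Ht; destruct x as [x x']; cbn [o1]; intros ->; oct.
Qed.

Lemma dom_add D x y : dom_ok D -> D x -> D y -> D (Oadd x y).
Proof.
  intros [-> | ->]; [|trivial]; destruct k; cbn [inA inF] in *; [|trivial].
  destruct x as [x x'], y as [y y']; cbn [o1]; intros -> ->; oct.
Qed.

(** Real orthogonality to F is orthogonality to 1 for the F-valued form; over the complex numbers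
    its two components are tested with 1 and i. *)
Lemma inPu_iff D x : inPu k D x <-> D x /\ form k O1 x = O0.
Proof.
  unfold inPu; split; intros [H H']; split; trivial.
  - destruct k; cbn [form].
    + generalize (H' O1 eq_refl); intros E; change (ofR (rform O1 x) = O0); now rewrite E.
    + generalize (H' O1 eq_refl) (H' (ofC (mkC 0 1)) eq_refl).
      clear; destruct_oct; unfold_oct; intros E E'.
      split_eq; trivial; lra.
  - intros t Ht; rewrite rform_form, form_conj.
    assert (E : form k x O1 = O0) by now apply form_sym0.
    replace t with (Omul O1 t) by apply Omul_1_l.
    rewrite form_linear, E by assumption; clear; oct.
Qed.

Lemma inPu_scale D x t : dom_ok D -> inF k t -> inPu k D x -> inPu k D (Omul x t).
Proof.
  rewrite !inPu_iff; intros HD Ht [H H']; split; [now apply dom_scale|].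
  rewrite form_linear, H' by assumption; clear; oct.
Qed.

Lemma inPu_add D x y : dom_ok D -> inPu k D x -> inPu k D y -> inPu k D (Oadd x y).
Proof.
  rewrite !inPu_iff; intros HD [H H'] [H1 H1']; split; [now apply dom_add|].
  rewrite form_add, H', H1'; clear; oct.
Qed.

Lemma sharp_rform f x y : inA k x -> inA k y -> rform (fn f x) (fn f y) = rform x y.
Proof.
  destruct (proj1 (proj2_sig f)) as [_ [_ [_ S]]]; intros; unfold fn; now rewrite !rform_form, S.
Qed.

Lemma sharp_sqnorm f x : inA k x -> sqnorm (fn f x) = sqnorm x.
Proof. intros H; exact (sharp_rform f H H). Qed.

Lemma sharp_form f x y : inA k x -> inA k y -> form k (fn f x) (fn f y) = form k x y.
Proof. destruct (proj1 (proj2_sig f)) as [_ [_ [_ S]]]; apply S. Qed.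

Lemma sharp_mul f x y : inA k x -> inA k y -> fn f (Omul x y) = Omul (fn f x) (fn f y).
Proof. destruct (proj1 (proj2_sig f)) as [_ [_ [S _]]]; apply S. Qed.

Lemma sharp_add f x y : inA k x -> inA k y -> fn f (Oadd x y) = Oadd (fn f x) (fn f y).
Proof. destruct (proj1 (proj2_sig f)) as [S _]; apply S. Qed.

Lemma sharp_linear f x t : inA k x -> inF k t -> fn f (Omul x t) = Omul (fn f x) t.
Proof. destruct (proj1 (proj2_sig f)) as [_ [S _]]; apply S. Qed.

(** Multiply uu = u on the right by the conjugate of u; alternativity cancels one factor. *)
Lemma unit_idempotent u : sqnorm u = 1 -> Omul u u = u -> u = O1.
Proof.
  intros N E.
  assert (H : Omul (Omul u u) (Oconj u) = Omul u (ofR (sqnorm u))) by (clear; oct).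
  assert (H' : Omul u (Oconj u) = ofR (sqnorm u)) by (clear; oct).
  rewrite E, H', N in H; change (ofR 1) with O1 in H; now rewrite Omul_1_r in H.
Qed.

Lemma sharp_1 f : fn f O1 = O1.
Proof.
  apply unit_idempotent.
  - rewrite sharp_sqnorm by apply inA_O1; clear; unfold O1; unfold_oct; ring.
  - rewrite <- sharp_mul by apply inA_O1; f_equal; apply Omul_1_l.
Qed.

Lemma sharp_F f t : inF k t -> fn f t = t.
Proof.
  intros Ht; rewrite <- (Omul_1_l t) at 1.
  rewrite sharp_linear, sharp_1 by auto using inA_O1; apply Omul_1_l.
Qed.

Lemma sharp_pure f x : inPu k (inA k) x -> inPu k (fun _ => True) (fn f x).
Proof.
  intros [Hx H]; split; [exact I|]; intros t Ht.
  rewrite <- (sharp_F f Ht), sharp_rform by auto using inF_inA; now apply H.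
Qed.

(** The line [x, f x] is incident with both points and both planes, so the square is filled by four
    triangles around it. *)
Lemma square_of_agreement P Q f g x y z :
  inPu k (inA k) x -> x <> O0 ->
  proj1_sig P = pointset k y -> proj1_sig Q = pointset k z ->
  form k x y = O0 -> form k x z = O0 -> fn f x = fn g x -> square P Q f g.
Proof.
  intros Hx Nx HP HQ Fy Fz E.
  assert (HL : exists x' u, inPu k (inA k) x' /\ inPu k (fun _ => True) u /\
    sqnorm x' = sqnorm u /\ x' <> O0 /\ lineset k x (fn f x) = lineset k x' u).
  { exists x, (fn f x); split; [exact Hx|split; [now apply sharp_pure|split; [|split; auto]]].
    symmetry; apply sharp_sqnorm, Hx. }
  set (L := exist _ (lineset k x (fn f x)) HL : line k).
  assert (A1 : adj (Gamma k) (Ln L) (Pt P)).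
  { split; [discriminate|left]; exists x, (fn f x), y; auto. }
  assert (A2 : adj (Gamma k) (Ln L) (Pt Q)).
  { split; [discriminate|left]; exists x, (fn f x), z; auto. }
  assert (A3 : adj (Gamma k) (Ln L) (Pl f)).
  { split; [discriminate|left]; exists x, (fn f x); auto. }
  assert (A4 : adj (Gamma k) (Ln L) (Pl g)).
  { split; [discriminate|left]; exists x, (fn f x); auto. }
  unfold square.
  rewrite <- (@triangle k (Pl f) (Ln L) (Pt P) [Pl g]) by auto using adj_sym, adj_pl_pt.
  rewrite <- (@triangle k (Pl f) (Ln L) (Pt Q) [Pl g]) by auto using adj_sym, adj_pl_pt.
  rewrite (@triangle k (Ln L) (Pt P) (Pl g) []), (@triangle k (Ln L) (Pt Q) (Pl g) [])
    by auto using adj_pt_pl.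
  reflexivity.
Qed.

Record frame (D : Oc -> Prop) (a b : Oc) : Prop := {
  frame_pure1 : inPu k D a; frame_pure2 : inPu k D b;
  frame_unit1 : sqnorm a = 1; frame_unit2 : sqnorm b = 1;
  frame_orth : form k a b = O0 }.

Definition represents P x : Prop :=
  inPu k (inA k) x /\ sqnorm x = 1 /\ proj1_sig P = pointset k x.

Lemma pointset_scale x r : r <> 0 -> pointset k (Omul x (ofR r)) = pointset k x.
Proof.
  intros Hr; apply functional_extensionality; intros y; apply propositional_extensionality.
  assert (E : forall s t, inF k t -> inF k (Omul (ofR s) t)).
  { destruct k; cbn [inF]; intros s t ->; clear; oct. }
  split; intros [t [Ht ->]].
  - exists (Omul (ofR r) t); split; [now apply E|].
    apply Omul_F_assoc; auto using inF_ofR.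
  - exists (Omul (ofR (/ r)) t); split; [now apply E|].
    rewrite Omul_F_assoc, <- (@Omul_F_assoc (ofR r)) by auto using inF_ofR.
    replace (Omul (ofR r) (ofR (/ r))) with O1; [now rewrite Omul_1_l|].

    unfold O1; rewrite <- (Rinv_r r Hr); clear; oct.
Qed.

Lemma represents_exists P : exists x, represents P x.
Proof.
  destruct P as [S [x [Hx [Nx E]]]]; destruct (normalize Nx) as [r [Hr N]].
  exists (Omul x (ofR r)); split; [|split].
  - apply inPu_scale; auto using inF_ofR; now left.
  - exact N.
  - cbn; now rewrite pointset_scale.
Qed.

Lemma point_exists x : inPu k (inA k) x -> sqnorm x = 1 -> exists P, represents P x.
Proof.
  intros Hx N.
  assert (H : exists x', inPu k (inA k) x' /\ x' <> O0 /\ pointset k x = pointset k x')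
    by (exists x; auto using sqnorm_1_neq0).
  set (P := exist _ (pointset k x) H : point k); exists P.
  split; [exact Hx|split; [exact N|reflexivity]].
Qed.

Lemma square_agree P Q f g p q x : represents P p -> represents Q q ->
  inPu k (inA k) x -> sqnorm x = 1 -> form k x p = O0 -> form k x q = O0 -> fn f x = fn g x ->
  square P Q f g.
Proof.
  intros [_ [_ HP]] [_ [_ HQ]] Hx N; eapply square_of_agreement; eauto using sqnorm_1_neq0.
Qed.

(** * Reduction to squares with orthogonal points *)

Hypothesis frame_extend : forall D x, dom_ok D -> inPu k D x -> sqnorm x = 1 -> exists y, frame D x y.
Hypothesis frame_product : forall D x y, dom_ok D -> frame D x y ->
  frame D x (Omul x y) /\ frame D y (Omul x y).
(** Let [d] be the part of [q] orthogonal to [p]. If it vanishes, any unit orthogonal to [p] will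
    do; otherwise the product of [p] with the normalized [d] is orthogonal to both factors. *)
Lemma common_perp D p q : dom_ok D -> inPu k D p -> inPu k D q -> sqnorm p = 1 ->
  exists r, inPu k D r /\ sqnorm r = 1 /\ form k r p = O0 /\ form k r q = O0.
Proof.
  intros DA Hp Hq Np.
  set (d := Oadd q (Oopp (Omul p (form k p q)))).
  assert (Eq : q = Oadd d (Omul p (form k p q))) by (subst d; generalize (Omul p (form k p q)); clear; oct).
  assert (Hd : inPu k D d).
  { apply inPu_add; auto.
    replace (Oopp (Omul p (form k p q))) with (Omul (Omul p (form k p q)) (ofR (-1)))
      by (generalize (Omul p (form k p q)); clear; oct).
    auto using inPu_scale, inF_ofR, inF_form. }
  assert (Fd : form k p d = O0).
  { unfold d; rewrite form_add, form_opp, form_linear, form_self, Np by apply inF_form.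
    generalize (form k p q); clear; oct. }
  assert (S : forall r d', form k r p = O0 -> form k r d' = O0 ->
    form k r (Oadd d' (Omul p (form k p q))) = O0).
  { intros r d' H1 H2; rewrite form_add, form_linear, H1, H2 by apply inF_form.
    generalize (form k p q); clear; oct. }
  destruct (Req_dec (sqnorm d) 0) as [Z|Z].
  - apply sqnorm_eq0 in Z.
    destruct (@frame_extend _ p DA Hp Np) as [r [_ Hr _ Nr Or]].
    apply form_sym0 in Or.
    exists r; repeat split; auto; try apply Hr; rewrite Eq, Z.
    apply S; trivial; apply form_0_r.
  - assert (Nd : d <> O0) by (intros E; apply Z; rewrite E; clear; oct).
    destruct (normalize Nd) as [r [Hr N]].
    assert (F : frame D p (Omul d (ofR r))).
    { split; auto using inPu_scale, inF_ofR.
      rewrite form_linear, Fd by apply inF_ofR; clear; oct. }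
    destruct (frame_product DA F) as [[_ H2 _ N2 O2] [_ _ _ _ O3]].
    set (w := Omul p (Omul d (ofR r))) in *.
    apply form_sym0 in O2; apply form_sym0 in O3.
    exists w; repeat split; auto; try apply H2; rewrite Eq; apply S; trivial.
    rewrite form_linear in O3 by apply inF_ofR.
    replace d with (Omul (Omul d (ofR r)) (ofR (/ r))).
    + rewrite !form_linear, O3 by apply inF_ofR; clear; oct.
    + rewrite Omul_ofR, Rinv_r by assumption; apply Omul_1_r.
Qed.

Hypothesis plane_exists : forall x y a b, frame (inA k) x y -> frame (fun _ => True) a b ->
  exists f, fn f x = a /\ fn f y = b.
Hypothesis square_orth : forall P Q p q f g, represents P p -> represents Q q ->
  form k p q = O0 -> square P Q f g.

Lemma square_all P Q f g : square P Q f g.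
Proof.
  destruct (represents_exists P) as [p Hp], (represents_exists Q) as [q Hq].
  destruct (@common_perp (inA k) p q) as [r [Hr [Nr [Op Oq]]]]; try apply Hp; try apply Hq; [now left|].
  destruct (point_exists Hr Nr) as [S HS].
  apply square_trans with S; [apply square_sym|]; eapply square_orth; eauto.
Qed.

Lemma Gamma_simply_connected (e : Oc) :
  inPu k (inA k) e -> sqnorm e = 1 -> simply_connected (Gamma k).
Proof.
  intros He Ne; assert (DA : dom_ok (inA k)) by now left.
  assert (DO : dom_ok (fun _ => True)) by now right.
  destruct (point_exists He Ne) as [P0 _].
  destruct (@frame_extend _ e DA He Ne) as [e' F].
  assert (F' : frame (fun _ => True) e e').
  { destruct F as [[_ H1] [_ H2] ? ? ?]; split; auto; split; auto. }
  destruct (plane_exists F F') as [f0 _].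
  refine (flat_simply_connected square_all _ _ P0 f0).
  - intros [S [x [u [Hx [Hu [N [Nx E]]]]]]].
    destruct (normalize Nx) as [r [Hr N1]].
    destruct (@frame_extend _ (Omul x (ofR r)) DA) as [y [_ Hy _ Ny Oy]];
      auto using inPu_scale, inF_ofR.
    destruct (point_exists Hy Ny) as [P [_ [_ HP]]].
    exists P; split; [discriminate|left]; exists x, u, y; repeat split; auto.
    apply form_sym0; apply form_sym0 in Oy; rewrite form_linear in Oy by apply inF_ofR.
    rewrite <- (Omul_1_r (form k y x)); unfold O1; rewrite <- (Rinv_r r Hr).
    rewrite <- Omul_ofR, Oy; clear; oct.
  - intros [S [x [u [Hx [Hu [N [Nx E]]]]]]].
    destruct (normalize Nx) as [r [Hr N1]].
    assert (N2 : sqnorm (Omul u (ofR r)) = 1) by now rewrite sqnorm_scale, <- N, <- sqnorm_scale.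
    (* Extend the normalized [x] and [u] to frames; a plane matching these frames sends [x] to
       [u]. *)
    destruct (@frame_extend _ (Omul x (ofR r)) DA) as [y Fx]; auto using inPu_scale, inF_ofR.
    destruct (@frame_extend _ (Omul u (ofR r)) DO) as [v Fu]; auto using inPu_scale, inF_ofR.
    destruct (plane_exists Fx Fu) as [f [Ef _]].
    exists f; split; [discriminate|left]; exists x, u; split; auto.
    change (fn f x = u).
    rewrite <- (Omul_1_r (fn f x)), <- (Omul_1_r u); unfold O1; rewrite <- (Rinv_r r Hr).
    rewrite <- !Omul_ofR; f_equal; rewrite <- Ef; symmetry; apply sharp_linear, inF_ofR.
    apply Hx.
Qed.
End Generic.

(** * The geometry over the reals *)

Lemma ofR_inj0 r : ofR r = O0 -> r = 0.
Proof. intros H; change (ReO (ofR r) = 0); rewrite H; reflexivity. Qed.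

Lemma form_RH0 x y : form RH x y = O0 <-> rform x y = 0.
Proof.
  split; [apply ofR_inj0|]; intros H; change (ofR (rform x y) = O0); rewrite H; reflexivity.
Qed.

Lemma inPu_RH D x : inPu RH D x <-> D x /\ ReO x = 0.
Proof. rewrite inPu_iff, form_RH0, rform_1_l; reflexivity. Qed.

Lemma frame_RH D a b : frame RH D a b <-> D a /\ D b /\ rframe a b.
Proof.
  split.
  - intros [H1 H2 Na Nb H]; apply inPu_RH in H1, H2; apply form_RH0 in H.
    destruct H1, H2; repeat split; auto.
  - intros [Da [Db [Ha Hb Na Nb H]]]; split; auto; try now apply inPu_RH.
    now apply form_RH0.
Qed.

Lemma rframe_left a b : rframe a b -> rframe a (Omul a b).
Proof.
  intros F; pose proof (rframe_next (rframe_next F)) as H.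
  rewrite rframe_mul_next in H by assumption; now apply rframe_sym.
Qed.

Lemma rframe_opp_l a b : rframe a b -> rframe (Oopp a) b.
Proof.
  intros [Ha Hb Na Nb H]; split; auto.
  - change (ReO (Oopp a)) with (- ReO a); rewrite Ha; ring.
  - unfold sqnorm; rewrite rform_opp_l, rform_opp_r; fold (sqnorm a); rewrite Na; ring.
  - rewrite rform_opp_l, H; ring.
Qed.

Lemma rframe_opp_r a b : rframe a b -> rframe a (Oopp b).
Proof. intros H; apply rframe_sym, rframe_opp_l, rframe_sym, H. Qed.

(** Coordinates with respect to x, y, xy are reused with respect to a, b, ab; [projA] makes the map
    factor through H, as [plane] demands. *)
Definition frame_plane (x y a b : Oc) (w : Oc) : Oc :=
  let v := projA RH w in
  rcomb a b (Omul a b) (ReO v) (rform x v) (rform y v) (rform (Omul x y) v).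

Lemma rcomb_form a b t x y z t' x' y' z' : rframe a b ->
  rform (rcomb a b (Omul a b) t x y z) (rcomb a b (Omul a b) t' x' y' z') =
  t * t' + x * x' + y * y' + z * z'.
Proof.
  intros F; rewrite rform_rcomb_l.
  now destruct (rcomb_coordinates t' x' y' z' F) as [-> [-> [-> ->]]].
Qed.

Lemma frame_plane_comb x y a b t r s u : rframe x y -> o1 x = Q0 -> o1 y = Q0 ->
  frame_plane x y a b (rcomb x y (Omul x y) t r s u) = rcomb a b (Omul a b) t r s u.
Proof.
  intros F Qx Qy.
  assert (E : projA RH (rcomb x y (Omul x y) t r s u) = rcomb x y (Omul x y) t r s u).
  { clear F; destruct x as [x x'], y as [y y']; cbn [o1] in *; subst; unfold rcomb.
    unfold projA; oct. }
  unfold frame_plane; rewrite E.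
  now destruct (rcomb_coordinates t r s u F) as [-> [-> [-> ->]]].
Qed.

(** Sums, products and the form have the same coordinate formulas in every [rframe]. *)
Lemma frame_plane_sharp x y a b : rframe x y -> o1 x = Q0 -> o1 y = Q0 -> rframe a b ->
  is_sharp RH (frame_plane x y a b).
Proof.
  intros F Qx Qy F'; repeat split; cbn [inA inF form].
  - intros v w Hv Hw.
    rewrite (quaternion_complete F Qx Qy Hv), (quaternion_complete F Qx Qy Hw).
    now rewrite rcomb_add, !frame_plane_comb, rcomb_add.
  - intros v t Hv Ht.
    rewrite Ht, (quaternion_complete F Qx Qy Hv).
    now rewrite rcomb_scale, !frame_plane_comb, rcomb_scale.
  - intros v w Hv Hw.
    rewrite (quaternion_complete F Qx Qy Hv), (quaternion_complete F Qx Qy Hw).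
    now rewrite rcomb_mul, !frame_plane_comb, rcomb_mul.
  - intros v w Hv Hw.
    rewrite (quaternion_complete F Qx Qy Hv), (quaternion_complete F Qx Qy Hw).
    rewrite !frame_plane_comb by assumption.
    match goal with |- ofR (ReO (Omul (Oconj ?a) ?b)) = ofR (ReO (Omul (Oconj ?c) ?d)) =>
      change (ofR (rform a b) = ofR (rform c d)) end.
    now rewrite !rcomb_form.
Qed.

Lemma RH_plane_exists x y a b : frame RH (inA RH) x y -> frame RH (fun _ => True) a b ->
  exists f : plane RH, fn f x = a /\ fn f y = b.
Proof.
  intros H H'; apply frame_RH in H as [Qx [Qy F]]; apply frame_RH in H' as [_ [_ F']].
  exists (exist _ (frame_plane x y a b) (conj (frame_plane_sharp F Qx Qy F') (fun _ => eq_refl))).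
  unfold fn; cbn [proj1_sig].
  assert (Ex : x = rcomb x y (Omul x y) 0 1 0 0) by (generalize (Omul x y); unfold rcomb; clear; oct).
  assert (Ey : y = rcomb x y (Omul x y) 0 0 1 0) by (generalize (Omul x y); unfold rcomb; clear; oct).
  split; [rewrite Ex at 2|rewrite Ey at 2]; rewrite frame_plane_comb by assumption;
    generalize (Omul a b); unfold rcomb; clear; oct.
Qed.

Definition e_i : Oc := mkO (mkQ (mkC 0 1) C0) Q0.
Definition e_j : Oc := mkO (mkQ C0 (mkC 1 0)) Q0.

Lemma residual_norm e x : sqnorm x = 1 ->
  sqnorm (Oadd e (Oopp (Omul x (ofR (rform e x))))) = sqnorm e - rform e x * rform e x.
Proof.
  intros N; unfold sqnorm.
  rewrite !rform_add_l, !rform_add_r, !rform_opp_l, !rform_opp_r, !rform_scale_l, !rform_scale_r.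
  rewrite (rform_sym x e); fold (sqnorm x); rewrite N; ring.
Qed.

Lemma RH_frame_extend D x : dom_ok RH D -> inPu RH D x -> sqnorm x = 1 -> exists y, frame RH D x y.
Proof.
  intros HD Hx N.
  assert (Hij : inPu RH D e_i /\ inPu RH D e_j).
  { rewrite !inPu_RH; repeat split; destruct HD as [-> | ->]; try reflexivity; exact I. }
  (* A unit cannot be parallel to both i and j, so one of them has a nonzero part orthogonal to
     [x]. *)
  assert (E : exists e, inPu RH D e /\ sqnorm e - rform e x * rform e x <> 0).
  { destruct (Req_dec (sqnorm e_i - rform e_i x * rform e_i x) 0) as [Z|Z]; [|exists e_i; tauto].
    exists e_j; split; [tauto|]; intros Z'.
    rewrite Oc_sum_squares in N.
    destruct x as [[[x0 x1] [x2 x3]] [[x4 x5] [x6 x7]]]; unfold e_i, e_j in *; unfold_oct.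
    ring_simplify in Z; ring_simplify in Z'; nra. }
  destruct E as [e [He Ne]].
  set (d := Oadd e (Oopp (Omul x (ofR (rform e x))))).
  assert (Nd : d <> O0).
  { intros Z; apply Ne; rewrite <- residual_norm by assumption; fold d; rewrite Z; clear; oct. }
  assert (Hd : inPu RH D d).
  { unfold d; rewrite <- Omul_minus_1; repeat (apply inPu_add || apply inPu_scale); auto using inF_ofR. }
  destruct (normalize Nd) as [r [Hr Nr]].
  exists (Omul d (ofR r)); split; auto using inPu_scale, inF_ofR.
  apply form_RH0; rewrite rform_scale_r; unfold d.
  rewrite rform_add_r, rform_opp_r, rform_scale_r, (rform_sym x e); fold (sqnorm x); rewrite N; ring.
Qed.

Lemma RH_frame_product D x y : dom_ok RH D -> frame RH D x y ->
  frame RH D x (Omul x y) /\ frame RH D y (Omul x y).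
Proof.
  rewrite !frame_RH; intros HD [Dx [Dy F]].
  assert (D (Omul x y)).
  { destruct HD as [-> | ->]; [|exact I]; cbn [inA] in *.
    clear F; destruct x as [x x'], y as [y y']; cbn [o1] in *; subst; clear; oct. }
  auto using rframe_left, rframe_next.
Qed.

Definition imag (a b c d e f g : R) : Oc := mkO (mkQ (mkC 0 a) (mkC b c)) (mkQ (mkC d e) (mkC f g)).

(* The squared lengths of the projections of the seven standard units onto span(p, q, r) add up to 3. *)
Lemma orthonormal_triple_extend p q r : rframe p q -> rframe p r -> rframe q r ->
  exists n, rframe n p /\ rframe n q /\ rframe n r.
Proof.
  intros [Hp Hq Np Nq Hpq] [_ Hr _ Nr Hpr] [_ _ _ _ Hqr].
  set (res e := Oadd e (Oopp (Oadd (Omul p (ofR (rform e p)))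
    (Oadd (Omul q (ofR (rform e q))) (Omul r (ofR (rform e r))))))).
  assert (Nres : forall e, sqnorm (res e) =
    sqnorm e - rform e p * rform e p - rform e q * rform e q - rform e r * rform e r).
  { intros e; unfold sqnorm, res.
    rewrite !rform_add_l, !rform_add_r, !rform_opp_l, !rform_opp_r, !rform_add_l, !rform_add_r.
    rewrite !rform_scale_l, !rform_scale_r.
    rewrite (rform_sym p e), (rform_sym q e), (rform_sym r e), (rform_sym q p), (rform_sym r p), (rform_sym r q).
    fold (sqnorm p) (sqnorm q) (sqnorm r); rewrite Np, Nq, Nr, Hpq, Hpr, Hqr; ring. }
  assert (E : exists e, ReO e = 0 /\ sqnorm (res e) <> 0).
  { apply NNPP; intros A.
    assert (Z : forall e, ReO e = 0 -> sqnorm (res e) = 0).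
    { intros e He; apply NNPP; intros B; apply A; now exists e. }
    pose proof (Z (imag 1 0 0 0 0 0 0) eq_refl) as Z1; pose proof (Z (imag 0 1 0 0 0 0 0) eq_refl) as Z2.
    pose proof (Z (imag 0 0 1 0 0 0 0) eq_refl) as Z3; pose proof (Z (imag 0 0 0 1 0 0 0) eq_refl) as Z4.
    pose proof (Z (imag 0 0 0 0 1 0 0) eq_refl) as Z5; pose proof (Z (imag 0 0 0 0 0 1 0) eq_refl) as Z6.
    pose proof (Z (imag 0 0 0 0 0 0 1) eq_refl) as Z7.
    rewrite Nres in Z1, Z2, Z3, Z4, Z5, Z6, Z7; clear Z A Nres; clear res.
    rewrite Oc_sum_squares in Np, Nq, Nr; clear Hpq Hpr Hqr.
    destruct p as [[[p0 p1] [p2 p3]] [[p4 p5] [p6 p7]]], q as [[[u0 u1] [u2 u3]] [[u4 u5] [u6 u7]]],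
      r as [[[r0 r1] [r2 r3]] [[r4 r5] [r6 r7]]]; unfold imag in *; unfold_oct; subst.
    ring_simplify in Z1; ring_simplify in Z2; ring_simplify in Z3; ring_simplify in Z4.
    ring_simplify in Z5; ring_simplify in Z6; ring_simplify in Z7; lra. }
  destruct E as [e [He Ne]].
  assert (Nd : res e <> O0) by (intros Z; apply Ne; rewrite Z; clear; oct).
  destruct (normalize Nd) as [s [Hs N]].
  assert (Re : ReO (res e) = 0).
  { rewrite <- rform_1_l; unfold res.
    rewrite !rform_add_r, !rform_opp_r, !rform_add_r, !rform_scale_r, !rform_1_l, He, Hp, Hq, Hr; ring. }
  assert (Rs : ReO (Omul (res e) (ofR s)) = 0).
  { rewrite <- rform_1_l, rform_scale_r, rform_1_l, Re; ring. }
  exists (Omul (res e) (ofR s)).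
  repeat split; auto; rewrite rform_scale_l; unfold res;
    rewrite !rform_add_l, !rform_opp_l, !rform_add_l, !rform_scale_l.
  - rewrite (rform_sym q p), (rform_sym r p); fold (sqnorm p); rewrite Np, Hpq, Hpr; ring.
  - rewrite (rform_sym r q); fold (sqnorm q); rewrite Nq, Hpq, Hqr; ring.
  - fold (sqnorm r); rewrite Nr, Hpr, Hqr; ring.
Qed.

Lemma rframe_comb_r x a b s t : rframe x a -> rframe x b -> rform a b = 0 -> s * s + t * t = 1 ->
  rframe x (Oadd (Omul a (ofR s)) (Omul b (ofR t))).
Proof.
  intros [Hx Ha Nx Na Oa] [_ Hb _ Nb Ob] H E; split; auto.
  - rewrite <- rform_1_l, rform_add_r, !rform_scale_r, !rform_1_l, Ha, Hb; ring.
  - unfold sqnorm; rewrite !rform_add_r, !rform_add_l, !rform_scale_r, !rform_scale_l.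
    rewrite (rform_sym b a), H; fold (sqnorm a); fold (sqnorm b); rewrite Na, Nb.
    transitivity (s * s + t * t); [ring|exact E].
  - rewrite rform_add_r, !rform_scale_r, Oa, Ob; ring.
Qed.

Lemma Omul_comb_r x a b s t :
  Omul x (Oadd (Omul a (ofR s)) (Omul b (ofR t))) =
  Oadd (Omul (Omul x a) (ofR s)) (Omul (Omul x b) (ofR t)).
Proof. oct. Qed.

Lemma Omul_comb_l x a b s t :
  Omul (Oadd (Omul a (ofR s)) (Omul b (ofR t))) x =
  Oadd (Omul (Omul a x) (ofR s)) (Omul (Omul b x) (ofR t)).
Proof. oct. Qed.

Lemma rframe_mul_cycle a b : rframe a b -> Omul (Omul a b) a = b.
Proof.
  intros F; rewrite <- (rframe_mul_next F) at 2; apply rframe_mul_next, rframe_next, F.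
Qed.

Lemma rframe_mul_last a b : rframe a b -> Omul (Omul a b) b = Oopp a.
Proof. intros []; now apply right_unit_square. Qed.

(** The failure of associativity on which the real case rests: p(nq) = -n(pq) by moving n to the
    left, while (pn)q = -(pq)n = n(pq) by moving it to the right. *)
Lemma anti_associative p q n : rframe p q -> rframe n p -> rframe n q -> rframe n (Omul p q) ->
  Omul p (Omul n q) = Oopp (Omul (Omul p n) q).
Proof.
  intros Fpq [Hn Hp _ _ Op] [_ Hq _ _ Oq] Fn.
  rewrite (left_anticommute _ Hp Hn) by now rewrite rform_sym.
  rewrite (right_anticommute _ Hn Hq Oq), <- (rframe_anticommute Fn).
  now rewrite Oopp_involutive.
Qed.

(** * Squares on an orthogonal triangle of points over the reals *)

Section OrthogonalPair.
Variables (P1 P2 P3 : point RH) (f1 f2 f3 : Oc).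
Hypotheses (R1 : represents P1 f1) (R2 : represents P2 f2) (R3 : represents P3 f3).
Hypotheses (F12 : frame RH (inA RH) f1 f2) (E3 : Omul f1 f2 = f3).

Let F := proj2 (proj2 (proj1 (frame_RH (inA RH) f1 f2) F12)).

Lemma RH_orth13 : form RH f1 f3 = O0.
Proof. apply form_RH0; rewrite <- E3; apply (rframe_left F). Qed.

Lemma RH_orth23 : form RH f2 f3 = O0.
Proof. apply form_RH0; rewrite <- E3; apply (rframe_next F). Qed.

(** The vectors [f2], [f1] and [f3] are the poles of the pairs P1 P3, P2 P3 and P1 P2, and planes
    that agree at a pole bound a square with its pair. At [f3] the value is the product of the other
    two. *)
Lemma RH_square13 g h : fn g f2 = fn h f2 -> square P1 P3 g h.
Proof.
  intros E; apply square_agree with (x := f2) (p := f1) (q := f3); auto; try apply R2.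
  - apply form_sym0, (frame_orth F12).
  - apply RH_orth23.
Qed.

Lemma RH_square12 g h : fn g f1 = fn h f1 -> square P2 P3 g h.
Proof.
  intros E; apply square_agree with (x := f1) (p := f2) (q := f3); auto; try apply R1.
  - apply (frame_orth F12).
  - apply RH_orth13.
Qed.

Lemma RH_square_mul g h :
  Omul (fn g f1) (fn g f2) = Omul (fn h f1) (fn h f2) -> square P1 P2 g h.
Proof.
  intros E; apply square_agree with (x := f3) (p := f1) (q := f2); auto; try apply R3.
  - apply form_sym0, RH_orth13.
  - apply form_sym0, RH_orth23.
  - rewrite <- E3, !sharp_mul; auto; try apply R1; apply R2.
Qed.

Lemma RH_frame_plane a b : rframe a b -> exists g : plane RH, fn g f1 = a /\ fn g f2 = b.
Proof. intros H; apply RH_plane_exists; auto; apply frame_RH; auto. Qed.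

(* The path P1 - g - P3 depends only on g f2.  Up to sign, four right multiplications, by the values q, u, n and
   u(nq) at f3, send the value nq of the first plane at f2 back to itself, but the value p of the second one to -q. *)
Lemma RH_square_rotate p q g h : rframe p q -> fn g f2 = p -> fn h f2 = Oopp q -> square P1 P3 g h.
Proof.
  intros Fpq Eg Eh.
  destruct (orthonormal_triple_extend Fpq (rframe_left Fpq) (rframe_next Fpq)) as [n [Fnp [Fnq Fnpq]]].
  (* The factor that makes the diagonals p + q and p - q units. *)
  set (s := sqrt (/ 2)).
  assert (Hs : s * s = / 2) by (apply sqrt_sqrt; lra).
  set (u := Oadd (Omul p (ofR s)) (Omul q (ofR s))).
  set (v := Oadd (Omul p (ofR s)) (Omul q (ofR (- s)))).
  pose proof (rframe_orth Fpq) as Opq.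
  assert (Fnu : rframe n u) by (apply rframe_comb_r; auto; lra).
  assert (Fnv : rframe n v) by (apply rframe_comb_r; auto; lra).
  (* F1 to F4 and G1 to G4 are the values at [f1], [f2] of the planes a1 to a4 and b1 to b4. Each
     a_i agrees with b_i at [f3]. Consecutive planes of either row agree at [f1], then at [f2], then
     at [f1]; moreover a1 and a4 agree at [f2], whereas b1 and b4 take the values p and -q there. *)
  assert (F1 : rframe (Oopp n) (Omul n q)) by now apply rframe_opp_l, rframe_left.
  assert (F2 : rframe (Oopp n) (Omul n u)) by now apply rframe_opp_l, rframe_left.
  assert (F3 : rframe u (Omul n u)) by now apply rframe_next.
  assert (F4 : rframe u (Omul n q)).
  { apply rframe_sym, rframe_comb_r; auto; [split| |lra].
    all: try apply Fpq; try apply F1.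
    - rewrite right_skew by apply Fpq. rewrite (rframe_orth Fnpq); ring.
    - apply rframe_sym, rframe_next, Fnq. }
  assert (G1 : rframe (Omul p q) p) by now apply rframe_sym, rframe_left.
  assert (G2 : rframe (Omul p q) v).
  { apply rframe_comb_r; auto; [apply rframe_sym, rframe_next, Fpq|lra]. }
  assert (G3 : rframe (Omul v n) v) by now apply rframe_sym, rframe_left, rframe_sym.
  assert (G4 : rframe (Omul v n) (Oopp q)).
  { apply rframe_opp_r; split; try apply Fpq; try apply G3.
    unfold v; rewrite Omul_comb_l, rform_add_l, !rform_scale_l.
    rewrite (rframe_orth (rframe_sym (rframe_left (rframe_sym Fnq)))).
    rewrite left_skew, (rframe_orth Fnpq) by apply Fpq; ring. }
  destruct (RH_frame_plane F1) as [a1 [A1 B1]], (RH_frame_plane F2) as [a2 [A2 B2]].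
  destruct (RH_frame_plane F3) as [a3 [A3 B3]], (RH_frame_plane F4) as [a4 [A4 B4]].
  destruct (RH_frame_plane G1) as [b1 [C1 D1]], (RH_frame_plane G2) as [b2 [C2 D2]].
  destruct (RH_frame_plane G3) as [b3 [C3 D3]], (RH_frame_plane G4) as [b4 [C4 D4]].
  apply square_trans_planes with b1; [apply RH_square13; congruence|].
  apply square_trans_planes with b4; [|apply RH_square13; congruence].
  apply square_by_loops with (P2 := P2) (f1 := a1) (f2 := a2) (f3 := a3) (f4 := a4) (g2 := b2) (g3 := b3).
  - apply RH_square_mul; rewrite A1, B1, C1, D1.
    rewrite Omul_opp_l, left_unit_square, Oopp_involutive by apply Fnp.
    now rewrite rframe_mul_cycle.
  - apply RH_square_mul; rewrite A2, B2, C2, D2.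
    rewrite Omul_opp_l, left_unit_square, Oopp_involutive by apply Fnp.
    unfold v; rewrite Omul_comb_r, rframe_mul_cycle, rframe_mul_last by assumption.
    unfold u; generalize s; clear; oct.
  - apply RH_square_mul; rewrite A3, B3, C3, D3.
    now rewrite rframe_mul_next, rframe_mul_cycle by (assumption || now apply rframe_sym).
  (* Here u(nq) = -(vn)q: the terms in p match by [anti_associative], those in q inside a quaternion
     algebra. *)
  - apply RH_square_mul; rewrite A4, B4, C4, D4, Omul_opp_r.
    unfold u, v; rewrite !Omul_comb_l, (anti_associative Fpq Fnp Fnq Fnpq), (rframe_mul_next Fnq).
    rewrite (rframe_mul_cycle (rframe_sym Fnq)).
    generalize (Omul (Omul p n) q) s; clear; oct.
  - apply square_sym, RH_square12; congruence.
  - apply square_sym, RH_square12; congruence.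
  - apply square_sym, RH_square13; congruence.
  - apply square_sym, RH_square13; congruence.
  - apply square_sym, RH_square12; congruence.
  - apply square_sym, RH_square12; congruence.
  - apply square_sym, RH_square13; congruence.
Qed.
 
(** [RH_square_rotate] joins planes with orthogonal values at [f2]; any two planes are joined
    through a third one whose value there is orthogonal to both of theirs. *)
Lemma RH_square_frame g h : square P1 P3 g h.
Proof.
  assert (DO : dom_ok RH (fun _ => True)) by now right.
  assert (V : forall k : plane RH, inPu RH (fun _ => True) (fn k f2) /\ sqnorm (fn k f2) = 1).
  { intros k; split; [apply sharp_pure, R2|]; rewrite sharp_sqnorm; apply R2. }
  destruct (V g) as [Hg Ng], (V h) as [Hh Nh].
  destruct (@common_perp RH RH_frame_extend RH_frame_product _ _ _ DO Hg Hh Ng) as [r [Hr [Nr [Og Oh]]]].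
  destruct (RH_frame_extend DO Hr Nr) as [s Fs]; apply frame_RH in Fs as [_ [_ Fs]].
  destruct (RH_frame_plane (rframe_sym Fs)) as [k [_ Ek]].
  assert (Q : forall a b, inPu RH (fun _ => True) a -> inPu RH (fun _ => True) b ->
    sqnorm a = 1 -> sqnorm b = 1 -> form RH a b = O0 -> rframe a (Oopp b)).
  { intros a b Ha Hb Na Nb H; apply rframe_opp_r.
    now apply (frame_RH (fun _ => True)); split. }
  apply square_trans_planes with k.
  - apply RH_square_rotate with (p := fn g f2) (q := Oopp r); auto.
    + apply Q; auto; now apply form_sym0.
    + now rewrite Oopp_involutive.
  - apply RH_square_rotate with (p := r) (q := Oopp (fn h f2)); auto.
    now rewrite Oopp_involutive.
Qed.
End OrthogonalPair.

Lemma RH_square_orth (P Q : point RH) p q g h :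
  represents P p -> represents Q q -> form RH p q = O0 -> square P Q g h.
Proof.
  intros HP HQ H.
  assert (DA : dom_ok RH (inA RH)) by now left.
  assert (F : frame RH (inA RH) q p).
  { destruct HP as [Hp [Np _]], HQ as [Hq [Nq _]]; split; auto; now apply form_sym0. }
  destruct (RH_frame_product DA F) as [_ F'].
  destruct (point_exists (frame_pure2 F') (frame_unit2 F')) as [S HS].
  (* The third vertex of the triangle is qp, because p(qp) = q. *)
  apply RH_square_frame with (P2 := S) (f1 := p) (f2 := Omul q p) (f3 := q); auto.
  apply rframe_mul_next, (frame_RH (inA RH)), F.
Qed.

Lemma simply_connected_RH : simply_connected (Gamma RH).
Proof.
  apply Gamma_simply_connected with (e := e_i).
  - exact RH_frame_extend.
  - exact RH_frame_product.
  - exact RH_plane_exists.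
  - exact RH_square_orth.
  - apply inPu_RH; split; reflexivity.
  - unfold e_i; unfold_oct; ring.
Qed.

(** * Hermitian frames of the octonions *)

Definition ccomb (a b g : Oc) (t x y z : Cx) : Oc :=
  Oadd (ofC t) (Oadd (Omul a (ofC x)) (Oadd (Omul b (ofC y)) (Omul g (ofC z)))).

Record cframe (a b : Oc) : Prop := {
  cframe_pure1 : CpartO a = C0; cframe_pure2 : CpartO b = C0;
  cframe_unit1 : sqnorm a = 1; cframe_unit2 : sqnorm b = 1;
  cframe_orth : herm a b = C0 }.

Lemma herm_add_r x y z : herm x (Oadd y z) = Cadd (herm x y) (herm x z).
Proof. octC. Qed.
Lemma herm_scale_r x y c : herm x (Omul y (ofC c)) = Cmul (herm x y) c.
Proof. octC. Qed.
Lemma herm_conj x y : herm y x = Cconj (herm x y).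
Proof. octC. Qed.
Lemma herm_add_l x y z : herm (Oadd x y) z = Cadd (herm x z) (herm y z).
Proof. octC. Qed.
Lemma herm_scale_l x y c : herm (Omul x (ofC c)) y = Cmul (Cconj c) (herm x y).
Proof. octC. Qed.
Lemma herm_self x : herm x x = mkC (sqnorm x) 0.
Proof. oct. Qed.
Lemma herm_1_l x : herm O1 x = CpartO x.
Proof. oct. Qed.
Lemma rform_herm x y : rform x y = c0 (herm x y).
Proof. reflexivity. Qed.
Lemma CpartO_add x y : CpartO (Oadd x y) = Cadd (CpartO x) (CpartO y).
Proof. reflexivity. Qed.
Lemma CpartO_scale x c : CpartO (Omul x (ofC c)) = Cmul (CpartO x) c.
Proof. octC. Qed.
Lemma Omul_CC x s t : Omul (Omul x (ofC s)) (ofC t) = Omul x (ofC (Cmul s t)).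
Proof. octC. Qed.

(** The C-component of a product of pure elements is minus their hermitian product; the rest, ab +
    (a|b), is a cross product on C^3, conjugate-linear in both factors. *)
Lemma pure_mul_general a b x y : CpartO a = C0 -> CpartO b = C0 ->
  Omul (Omul a (ofC x)) (Omul b (ofC y)) =
  Oadd (ofC (Copp (Cmul (Cmul (Cconj x) y) (herm a b))))
       (Omul (Oadd (Omul a b) (ofC (herm a b))) (ofC (Cmul (Cconj x) (Cconj y)))).
Proof. octC. Qed.

Lemma pure_mul_orth a b x y : CpartO a = C0 -> CpartO b = C0 -> herm a b = C0 ->
  Omul (Omul a (ofC x)) (Omul b (ofC y)) = Omul (Omul a b) (ofC (Cmul (Cconj x) (Cconj y))).
Proof.
  intros Ha Hb H; rewrite (pure_mul_general _ _ Ha Hb), H.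
  generalize (Omul a b); clear; octC.
Qed.

Lemma pure_mul_self a x y : CpartO a = C0 -> sqnorm a = 1 ->
  Omul (Omul a (ofC x)) (Omul a (ofC y)) = ofC (Copp (Cmul (Cconj x) y)).
Proof.
  intros Ha N; rewrite (pure_mul_general _ _ Ha Ha), herm_self, N.
  rewrite square_imag by (destruct a as [[a ?] ?]; cbn in *; now subst).
  rewrite N; replace (Oadd (ofR (-1)) (ofC (mkC 1 0))) with O0 by (clear; oct).
  clear; oct.
Qed.

Lemma C_mul_pure t a x : CpartO a = C0 ->
  Omul (ofC t) (Omul a (ofC x)) = Omul a (ofC (Cmul (Cconj t) x)).
Proof. octC. Qed.

Lemma C_mul_C s t : Omul (ofC s) (ofC t) = ofC (Cmul s t).
Proof. octC. Qed.

Lemma herm_mul_r a b : CpartO a = C0 -> CpartO b = C0 -> herm b (Omul a b) = C0.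
Proof. octC. Qed.

Lemma CpartO_mul a b : CpartO a = C0 -> CpartO b = C0 -> CpartO (Omul a b) = Copp (herm a b).
Proof. octC. Qed.

Lemma cframe_rframe a b : cframe a b -> rframe a b.
Proof.
  intros [Ha Hb Na Nb H]; split; auto; try (rewrite rform_herm, H; reflexivity).
  - change (ReO a) with (c0 (CpartO a)); rewrite Ha; reflexivity.
  - change (ReO b) with (c0 (CpartO b)); rewrite Hb; reflexivity.
Qed.

Lemma cframe_sym a b : cframe a b -> cframe b a.
Proof. intros []; split; auto; rewrite herm_conj, cframe_orth0; apply Cconj_0. Qed.

Lemma cframe_next a b : cframe a b -> cframe b (Omul a b).
Proof.
  intros [Ha Hb Na Nb H]; split; auto.
  - rewrite CpartO_mul, H by assumption; clear; unfold Copp, C0; cbn; f_equal; ring.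
  - rewrite sqnorm_mul, Na, Nb; ring.
  - now apply herm_mul_r.
Qed.

Lemma cframe_left a b : cframe a b -> cframe a (Omul a b).
Proof.
  intros F; pose proof (cframe_next (cframe_next F)) as H.
  rewrite rframe_mul_next in H by now apply cframe_rframe.
  now apply cframe_sym.
Qed.

Lemma cframe_scale a b s t : Cmul (Cconj s) s = C1 -> Cmul (Cconj t) t = C1 ->
  cframe a b -> cframe (Omul a (ofC s)) (Omul b (ofC t)).
Proof.
  assert (N : forall x c, Cmul (Cconj c) c = C1 -> sqnorm x = 1 -> sqnorm (Omul x (ofC c)) = 1).
  { intros x c Hc Hx.
    assert (E : herm (Omul x (ofC c)) (Omul x (ofC c)) = C1).
    { rewrite herm_scale_l, herm_scale_r, herm_self, Hx; fold C1.
      transitivity (Cmul (Cconj c) c); [ring|exact Hc]. }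
    rewrite herm_self in E; change (c0 (mkC (sqnorm (Omul x (ofC c))) 0) = 1); rewrite E; reflexivity. }
  intros Hs Ht [Ha Hb Na Nb H]; split; auto.
  - rewrite CpartO_scale, Ha; ring.
  - rewrite CpartO_scale, Hb; ring.
  - rewrite herm_scale_l, herm_scale_r, H; ring.
Qed.

(** The coefficients are the same for every frame; hence [frame_map] is multiplicative. *)
Lemma ccomb_mul a b t x y z t' x' y' z' : cframe a b ->
  Omul (ccomb a b (Omul a b) t x y z) (ccomb a b (Omul a b) t' x' y' z') =
  ccomb a b (Omul a b)
    (Csub (Csub (Csub (Cmul t t') (Cmul (Cconj x) x')) (Cmul (Cconj y) y')) (Cmul (Cconj z) z'))
    (Cadd (Cadd (Cmul (Cconj t) x') (Cmul x t')) (Cconj (Csub (Cmul y z') (Cmul z y'))))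
    (Cadd (Cadd (Cmul (Cconj t) y') (Cmul y t')) (Cconj (Csub (Cmul z x') (Cmul x z'))))
    (Cadd (Cadd (Cmul (Cconj t) z') (Cmul z t')) (Cconj (Csub (Cmul x y') (Cmul y x')))).
Proof.
  intros F; pose proof (cframe_rframe F) as R.
  pose proof (cframe_next F) as F1; pose proof (cframe_left F) as F2.
  pose proof (cframe_rframe F1) as R1; pose proof (cframe_rframe F2) as R2.
  assert (E1 := rframe_mul_next R); assert (E2 := rframe_mul_cycle R).
  assert (E3 := rframe_anticommute R1); assert (E4 := rframe_anticommute R2).
  rewrite E1 in E3; rewrite <- (Oopp_involutive (Omul a (Omul a b))), <- E4, E2 in E4.
  assert (E5 : Omul a (Omul a b) = Oopp b).
  { destruct R; now apply left_unit_square. }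
  assert (E6 := rframe_anticommute R).
  unfold ccomb; rewrite !Omul_add_l, !Omul_add_r.
  destruct F as [Ha Hb Na Nb H], F1 as [_ Hg _ Ng H1], F2 as [_ _ _ _ H2].
  assert (H' : herm b a = C0) by (rewrite herm_conj, H; apply Cconj_0).
  assert (H1' : herm (Omul a b) b = C0) by (rewrite herm_conj, H1; apply Cconj_0).
  assert (H2' : herm (Omul a b) a = C0) by (rewrite herm_conj, H2; apply Cconj_0).
  rewrite !pure_mul_self, !pure_mul_orth, !C_mul_pure, !C_mul_C, !Omul_CC by assumption.
  rewrite E1, E2, E3, E5, E6.
  generalize (Omul a b); clear; intros g; octC.
Qed.

Lemma ccomb_add a b g t x y z t' x' y' z' :
  Oadd (ccomb a b g t x y z) (ccomb a b g t' x' y' z') =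
  ccomb a b g (Cadd t t') (Cadd x x') (Cadd y y') (Cadd z z').
Proof. unfold ccomb; octC. Qed.

Lemma ccomb_scale a b g t x y z r :
  Omul (ccomb a b g t x y z) (ofC r) = ccomb a b g (Cmul t r) (Cmul x r) (Cmul y r) (Cmul z r).
Proof. unfold ccomb; octC. Qed.

Lemma herm_ccomb_r u a b g t x y z : herm u (ccomb a b g t x y z) =
  Cadd (Cmul (herm u O1) t) (Cadd (Cmul (herm u a) x) (Cadd (Cmul (herm u b) y) (Cmul (herm u g) z))).
Proof.
  unfold ccomb; rewrite !herm_add_r, !herm_scale_r.
  now rewrite <- (Omul_1_l (ofC t)), herm_scale_r.
Qed.

Lemma ccomb_coordinates a b t x y z : cframe a b ->
  let u := ccomb a b (Omul a b) t x y z in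
  CpartO u = t /\ herm a u = x /\ herm b u = y /\ herm (Omul a b) u = z.
Proof.
  intros F u; subst u; pose proof (cframe_next F) as F1; pose proof (cframe_left F) as F2.
  rewrite <- herm_1_l, !herm_ccomb_r, !herm_self.
  rewrite (herm_conj O1 a), (herm_conj O1 b), (herm_conj O1 (Omul a b)), !herm_1_l.
  destruct F as [Ha Hb Na Nb H], F1 as [_ Hg _ Ng H1], F2 as [_ _ _ _ H2].
  rewrite (herm_conj a b), (herm_conj b (Omul a b)), (herm_conj a (Omul a b)).
  rewrite Ha, Hb, Hg, Na, Nb, Ng, H, H1, H2, Cconj_0.
  change (CpartO O1) with C1; replace (sqnorm O1) with 1 by (clear; oct); fold C1.
  repeat split; ring.
Qed.

(** The hermitian counterpart of [quaternion_gram], with ab + (a|b) as the cross product. *)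
Lemma pure_gram a b y : CpartO a = C0 -> CpartO b = C0 ->
  let h := herm a b in
  let d := Csub (Cmul (herm a a) (herm b b)) (Cmul h (Cconj h)) in
  Omul y (ofC d) =
  ccomb a b (Oadd (Omul a b) (ofC h)) (Cmul (CpartO y) d)
    (Csub (Cmul (herm b b) (herm a y)) (Cmul h (herm b y)))
    (Csub (Cmul (herm a a) (herm b y)) (Cmul (Cconj h) (herm a y)))
    (herm (Oadd (Omul a b) (ofC h)) y).
Proof. unfold ccomb; octC. Qed.

Lemma pure_complete a b y : cframe a b ->
  y = ccomb a b (Omul a b) (CpartO y) (herm a y) (herm b y) (herm (Omul a b) y).
Proof.
  intros [Ha Hb Na Nb H]; pose proof (pure_gram y Ha Hb) as E; cbv zeta in E.
  rewrite !herm_self, H, Na, Nb in E; fold C1 in E.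
  replace (Oadd (Omul a b) (ofC C0)) with (Omul a b) in E by (clear; oct).
  replace (Csub (Cmul C1 C1) (Cmul C0 (Cconj C0))) with C1 in E by (rewrite Cconj_0; ring).
  change (ofC C1) with O1 in E; rewrite Omul_1_r in E; rewrite E at 1.
  rewrite Cconj_0; f_equal; ring.
Qed.

(** * The group of sharp morphisms over the complex numbers *)

Lemma form_CO0 x y : form CO x y = O0 <-> herm x y = C0.
Proof.
  change (form CO x y) with (ofC (herm x y)); split; [|intros ->; reflexivity].
  intros E; change (CpartO (ofC (herm x y)) = C0); rewrite E; reflexivity.
Qed.

Lemma inPu_CO D x : inPu CO D x <-> D x /\ CpartO x = C0.
Proof. rewrite inPu_iff, form_CO0, herm_1_l; reflexivity. Qed.

Lemma frame_CO D a b : frame CO D a b <-> D a /\ D b /\ cframe a b.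
Proof.
  split.
  - intros [H1 H2 Na Nb H]; apply inPu_CO in H1, H2; apply form_CO0 in H.
    destruct H1, H2; repeat split; auto.
  - intros [Da [Db [Ha Hb Na Nb H]]]; split; auto; try now apply inPu_CO.
    now apply form_CO0.
Qed.

Lemma dom_CO D (x : Oc) : dom_ok CO D -> D x.
Proof. intros [-> | ->]; exact I. Qed.

Lemma inF_ofC c : inF CO (ofC c).
Proof. reflexivity. Qed.

Section Morphisms.
Implicit Types (f g h : plane CO) (v w : Oc).

Lemma plane_ext f g : (forall w, fn f w = fn g w) -> f = g.
Proof.
  destruct f as [f Hf], g as [g Hg]; unfold fn; cbn [proj1_sig]; intros E.
  apply functional_extensionality in E; subst g; f_equal; apply proof_irrelevance.
Qed.

Lemma fn_linear f x c : fn f (Omul x (ofC c)) = Omul (fn f x) (ofC c).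
Proof. apply sharp_linear; [exact I|apply inF_ofC]. Qed.
Lemma fn_add f x y : fn f (Oadd x y) = Oadd (fn f x) (fn f y).
Proof. apply sharp_add; exact I. Qed.
Lemma fn_mul f x y : fn f (Omul x y) = Omul (fn f x) (fn f y).
Proof. apply sharp_mul; exact I. Qed.
Lemma fn_C f c : fn f (ofC c) = ofC c.
Proof. apply sharp_F, inF_ofC. Qed.
Lemma fn_herm f x y : herm (fn f x) (fn f y) = herm x y.
Proof.
  pose proof (@sharp_form CO f x y I I) as H.
  change (CpartO (form CO (fn f x) (fn f y)) = CpartO (form CO x y)); now rewrite H.
Qed.

Lemma fn_ccomb f a b t x y z :
  fn f (ccomb a b (Omul a b) t x y z) = ccomb (fn f a) (fn f b) (Omul (fn f a) (fn f b)) t x y z.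
Proof. unfold ccomb; now rewrite !fn_add, !fn_linear, fn_mul, fn_C. Qed.

Lemma plane_ext_frame f g x y : cframe x y -> fn f x = fn g x -> fn f y = fn g y -> f = g.
Proof.
  intros F Ex Ey; apply plane_ext; intros w.
  rewrite (pure_complete w F), !fn_ccomb; now rewrite Ex, Ey.
Qed.

Lemma fn_cframe f x y : cframe x y -> cframe (fn f x) (fn f y).
Proof.
  intros [Hx Hy Nx Ny H]; split.
  - now rewrite <- herm_1_l, <- (sharp_1 f), fn_herm, herm_1_l.
  - now rewrite <- herm_1_l, <- (sharp_1 f), fn_herm, herm_1_l.
  - rewrite sharp_sqnorm; [assumption|exact I].
  - rewrite sharp_sqnorm; [assumption|exact I].
  - now rewrite fn_herm.
Qed.

Definition frame_map (x y a b w : Oc) : Oc :=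
  ccomb a b (Omul a b) (CpartO w) (herm x w) (herm y w) (herm (Omul x y) w).

Lemma frame_map_comb x y a b t r s u : cframe x y ->
  frame_map x y a b (ccomb x y (Omul x y) t r s u) = ccomb a b (Omul a b) t r s u.
Proof.
  intros F; unfold frame_map.
  now destruct (ccomb_coordinates t r s u F) as [-> [-> [-> ->]]].
Qed.

Lemma herm_ccomb a b t x y z t' x' y' z' : cframe a b ->
  herm (ccomb a b (Omul a b) t x y z) (ccomb a b (Omul a b) t' x' y' z') =
  Cadd (Cmul (Cconj t) t') (Cadd (Cmul (Cconj x) x') (Cadd (Cmul (Cconj y) y') (Cmul (Cconj z) z'))).
Proof.
  intros F; rewrite herm_ccomb_r.
  rewrite (herm_conj O1), (herm_conj a), (herm_conj b), (herm_conj (Omul a b)), herm_1_l.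
  now destruct (ccomb_coordinates t x y z F) as [-> [-> [-> ->]]].
Qed.

Lemma frame_map_sharp x y a b : cframe x y -> cframe a b -> is_sharp CO (frame_map x y a b).
Proof.
  intros F F'; split; [|split; [|split]]; cbn [inA inF form].
  - intros v w _ _; rewrite (pure_complete v F), (pure_complete w F).
    now rewrite ccomb_add, !frame_map_comb, ccomb_add.
  - intros v t _ ->; rewrite (pure_complete v F).
    now rewrite ccomb_scale, !frame_map_comb, ccomb_scale.
  - intros v w _ _; rewrite (pure_complete v F), (pure_complete w F).
    now rewrite ccomb_mul, !frame_map_comb, ccomb_mul.
  - intros v w _ _.
    match goal with |- ofC (CpartO (Omul (Oconj ?a) ?b)) = ofC (CpartO (Omul (Oconj ?c) ?d)) =>
      change (ofC (herm a b) = ofC (herm c d)) end.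
    rewrite (pure_complete v F), (pure_complete w F).
    now rewrite !frame_map_comb, !herm_ccomb.
Qed.

(** Together with [plane_ext_frame]: planes act simply transitively on hermitian frames, which
    identifies them with SU(3). *)
Lemma CO_plane_exists x y a b : cframe x y -> cframe a b -> exists f, fn f x = a /\ fn f y = b.
Proof.
  intros F F'.
  exists (exist _ (frame_map x y a b) (conj (frame_map_sharp F F') (fun _ => eq_refl))).
  unfold fn; cbn [proj1_sig].
  assert (Ex : x = ccomb x y (Omul x y) C0 C1 C0 C0) by (generalize (Omul x y); unfold ccomb; clear; oct).
  assert (Ey : y = ccomb x y (Omul x y) C0 C0 C1 C0) by (generalize (Omul x y); unfold ccomb; clear; oct).
  split; [rewrite Ex at 2|rewrite Ey at 2]; rewrite frame_map_comb by assumption;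
    generalize (Omul a b); unfold ccomb; clear; oct.
Qed.

Lemma comp_sharp f g : is_sharp CO (fun w => fn f (fn g w)).
Proof.
  split; [|split; [|split]]; cbn [inA].
  - intros; now rewrite !fn_add.
  - intros x t _ ->; now rewrite !fn_linear.
  - intros; now rewrite !fn_mul.
  - intros; now rewrite !(@sharp_form CO) by exact I.
Qed.

Definition comp f g : plane CO :=
  exist _ (fun w => fn f (fn g w)) (conj (comp_sharp f g) (fun _ => eq_refl)).

Lemma id_sharp : is_sharp CO (fun w => w).
Proof. repeat split. Qed.

Definition idp : plane CO := exist _ (fun w => w) (conj id_sharp (fun _ => eq_refl)).

Lemma fn_comp f g w : fn (comp f g) w = fn f (fn g w).
Proof. reflexivity. Qed.

Lemma fn_idp w : fn idp w = w.
Proof. reflexivity. Qed.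

Lemma comp_assoc f g h : comp (comp f g) h = comp f (comp g h).
Proof. now apply plane_ext. Qed.
Lemma comp_id_l f : comp idp f = f.
Proof. now apply plane_ext. Qed.
Lemma comp_id_r f : comp f idp = f.
Proof. now apply plane_ext. Qed.

Lemma standard_cframe : exists x y, cframe x y.
Proof.
  exists (mkO (mkQ C0 C1) Q0), (mkO Q0 (mkQ C1 C0)); split; unfold_oct; split_eq; ring.
Qed.

Lemma inverse_exists f : exists g, comp f g = idp /\ comp g f = idp.
Proof.
  destruct standard_cframe as [x [y F]]; pose proof (fn_cframe f F) as F'.
  destruct (CO_plane_exists F' F) as [g [Ex Ey]]; exists g; split.
  - apply plane_ext_frame with (1 := F'); rewrite fn_comp, fn_idp; congruence.
  - apply plane_ext_frame with (1 := F); rewrite fn_comp, fn_idp; congruence.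
Qed.

Lemma inverse_fn f g x y : comp g f = idp -> fn f x = y -> fn g y = x.
Proof. intros E <-; rewrite <- fn_comp, E; reflexivity. Qed.

(** * Elements fixing one axis of a frame *)

Definition unitC (s : Cx) : Prop := Cmul (Cconj s) s = C1.

Lemma unitC_conj s : unitC s -> unitC (Cconj s).
Proof. unfold unitC; intros <-; rewrite Cconj_involutive; ring. Qed.

Lemma unitC_conj_r s : unitC s -> Cmul s (Cconj s) = C1.
Proof. unfold unitC; intros <-; ring. Qed.

Lemma unitC_1 : unitC C1.
Proof. unfold unitC; rewrite Cconj_1; ring. Qed.

Lemma third_axis x y z : cframe y z -> cframe x y -> cframe x z ->
  exists c, x = Omul (Omul y z) (ofC c).
Proof.
  intros F [Hx _ _ _ Oy] [_ _ _ _ Oz].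
  exists (herm (Omul y z) x); rewrite (pure_complete x F) at 1.
  rewrite Hx, (herm_conj x y), (herm_conj x z), Oy, Oz, Cconj_0.
  unfold ccomb; generalize (Omul y z) (herm (Omul y z) x); clear; octC.
Qed.

(** The axis [x] is a scalar multiple of yz. For [a] and [b] in the span of [y] and [z], the
    condition on ab says that [f] has determinant 1 on that span. *)
Lemma fix_third f x y z a b : cframe y z -> cframe x y -> cframe x z ->
  fn f y = a -> fn f z = b -> Omul a b = Omul y z -> fn f x = x.
Proof.
  intros F Fy Fz Ey Ez E; destruct (third_axis F Fy Fz) as [c ->].
  now rewrite fn_linear, fn_mul, Ey, Ez, E.
Qed.

Definition diagonal (t : plane CO) x y z s : Prop :=
  fn t x = x /\ fn t y = Omul y (ofC s) /\ fn t z = Omul z (ofC (Cconj s)).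

Lemma diagonal_exists x y z s : cframe y z -> cframe x y -> cframe x z -> unitC s ->
  exists t, diagonal t x y z s.
Proof.
  intros F Fy Fz Hs.
  assert (F' : cframe (Omul y (ofC s)) (Omul z (ofC (Cconj s)))).
  { apply cframe_scale; auto; now apply unitC_conj. }
  destruct (CO_plane_exists F F') as [t [Ey Ez]]; exists t; split; auto.
  apply (fix_third F Fy Fz Ey Ez).
  rewrite pure_mul_orth by apply F.
  rewrite Cconj_involutive, Hs; exact (Omul_1_r _).
Qed.

(** Conjugation by this element exchanges the two eigenvalues of a diagonal one; [fixer_agree] uses
    this to write diagonal elements as commutators. *)
Lemma quarter_turn x y z : cframe y z -> cframe x y -> cframe x z ->
  exists n : plane CO, fn n x = x /\ fn n y = z /\ fn n z = Omul y (ofC (Copp C1)).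
Proof.
  intros F Fy Fz.
  assert (U : unitC (Copp C1)) by (unfold unitC; rewrite Cconj_opp, Cconj_1; ring).
  assert (F' : cframe z (Omul y (ofC (Copp C1)))).
  { rewrite <- (Omul_1_r z); change O1 with (ofC C1).
    apply cframe_scale; [exact unitC_1|exact U|now apply cframe_sym]. }
  destruct (CO_plane_exists F F') as [n [Ey Ez]]; exists n; split; auto.
  apply (fix_third F Fy Fz Ey Ez).
  pose proof (rframe_anticommute (cframe_rframe F)) as E.
  rewrite <- (Omul_1_r z) at 1; change O1 with (ofC C1).
  rewrite pure_mul_orth, E, Cconj_opp, Cconj_1 by apply (cframe_sym F).
  generalize (Omul y z); clear; oct.
Qed.

Lemma CO_frame_extend D x : dom_ok CO D -> inPu CO D x -> sqnorm x = 1 -> exists y, frame CO D x y.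
Proof.
  intros HD Hx N; assert (DD : forall w, D w) by (intros w; now apply dom_CO).
  apply inPu_CO in Hx as [_ Hx].
  set (res e := Oadd e (Oopp (Omul x (ofC (herm x e))))).
  assert (Nres : forall e, herm (res e) (res e) =
    Csub (herm e e) (Cmul (Cconj (herm x e)) (herm x e))).
  { intros e; unfold res.
    replace (Oopp (Omul x (ofC (herm x e)))) with (Omul x (ofC (Copp (herm x e))))
      by (generalize (herm x e); clear; octC).
    rewrite !herm_add_l, !herm_add_r, !herm_scale_l, !herm_scale_r, (herm_self x), N; fold C1.
    rewrite (herm_conj x e), Cconj_opp; ring. }
  assert (E : exists e, CpartO e = C0 /\ sqnorm (res e) <> 0).
  (* Two orthogonal units; [x] cannot be a complex multiple of both. *)
  { set (e1 := mkO (mkQ C0 C1) Q0); set (e2 := mkO Q0 (mkQ C1 C0)).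
    destruct (Req_dec (sqnorm (res e1)) 0) as [Z|Z]; [|now exists e1].
    exists e2; split; [reflexivity|]; intros Z'.
    pose proof (Nres e1) as A1; pose proof (Nres e2) as A2.
    rewrite herm_self, Z in A1; rewrite herm_self, Z' in A2.
    apply (f_equal c0) in A1; apply (f_equal c0) in A2; clear Nres Z Z'; clear res.
    rewrite Oc_sum_squares in N.
    destruct x as [[[x0 x1] [x2 x3]] [[x4 x5] [x6 x7]]]; unfold e1, e2 in *; unfold_oct.
    ring_simplify in A1; ring_simplify in A2; nra. }
  destruct E as [e [He Ne]].
  assert (Nd : res e <> O0) by (intros Z; apply Ne; rewrite Z; clear; oct).
  destruct (normalize Nd) as [r [Hr Nr]].
  exists (Omul (res e) (ofR r)); apply frame_CO; split; [|split]; auto; split; auto.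
  - change (ofR r) with (ofC (mkC r 0)); rewrite CpartO_scale; unfold res.
    replace (Oopp (Omul x (ofC (herm x e)))) with (Omul x (ofC (Copp (herm x e))))
      by (generalize (herm x e); clear; octC).
    rewrite CpartO_add, CpartO_scale, He, Hx; ring.
  - change (ofR r) with (ofC (mkC r 0)); rewrite herm_scale_r; unfold res.
    replace (Oopp (Omul x (ofC (herm x e)))) with (Omul x (ofC (Copp (herm x e))))
      by (generalize (herm x e); clear; octC).
    rewrite herm_add_r, herm_scale_r, (herm_self x), N; fold C1; ring.
Qed.

Lemma CO_frame_product D x y : dom_ok CO D -> frame CO D x y ->
  frame CO D x (Omul x y) /\ frame CO D y (Omul x y).
Proof.
  rewrite !frame_CO; intros HD [_ [_ F]].
  assert (DD : forall w, D w) by (intros w; now apply dom_CO).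
  auto using cframe_left, cframe_next.
Qed.
End Morphisms.

(** * Factorization and diagonalization in SU(3) *)

Section Structure.
Implicit Types (f g h : plane CO) (v w : Oc).

Lemma sqnorm_herm x r : sqnorm x = r <-> herm x x = mkC r 0.
Proof. rewrite herm_self; split; [now intros ->|now intros [=]]. Qed.

Lemma cframe_perp x : CpartO x = C0 -> sqnorm x = 1 -> exists y, cframe x y.
Proof.
  intros Hx N; destruct (@CO_frame_extend (fun _ => True) x) as [y F]; auto.
  - now right.
  - now apply inPu_CO.
  - exists y; now apply frame_CO in F.
Qed.

Lemma cframe_comb_r z x y a b : cframe z x -> cframe z y -> cframe x y ->
  Cadd (Cmul (Cconj a) a) (Cmul (Cconj b) b) = C1 ->
  cframe z (Oadd (Omul x (ofC a)) (Omul y (ofC b))).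
Proof.
  intros [Hz Hx Nz Nx Ox] [_ Hy _ Ny Oy] [_ _ _ _ O] E; split; auto.
  - rewrite CpartO_add, !CpartO_scale, Hx, Hy; ring.
  - apply sqnorm_herm; rewrite !herm_add_l, !herm_add_r, !herm_scale_l, !herm_scale_r.
    rewrite (herm_conj x y), O, Cconj_0, !herm_self, Nx, Ny; fold C1.
    transitivity (Cadd (Cmul (Cconj a) a) (Cmul (Cconj b) b)); [ring|exact E].
  - rewrite herm_add_r, !herm_scale_r, Ox, Oy; ring.
Qed.

Lemma split_along p v : CpartO p = C0 -> sqnorm p = 1 -> CpartO v = C0 -> sqnorm v = 1 ->
  exists u a b, cframe p u /\ v = Oadd (Omul p (ofC a)) (Omul u (ofC b)) /\
    Cadd (Cmul (Cconj a) a) (Cmul (Cconj b) b) = C1.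
Proof.
  intros Hp Np Hv Nv; set (a := herm p v).
  assert (Conv : forall u b, cframe p u -> v = Oadd (Omul p (ofC a)) (Omul u (ofC b)) ->
    Cadd (Cmul (Cconj a) a) (Cmul (Cconj b) b) = C1).
  { intros u b [_ _ _ Nu O] E; apply sqnorm_herm in Nv; rewrite E in Nv.
    rewrite !herm_add_l, !herm_add_r, !herm_scale_l, !herm_scale_r in Nv.
    rewrite (herm_conj p u), O, Cconj_0, !herm_self, Np, Nu in Nv; fold C1 in Nv.
    etransitivity; [|exact Nv]; ring. }
  set (d := Oadd v (Omul p (ofC (Copp a)))).
  assert (Ev : v = Oadd (Omul p (ofC a)) d) by (unfold d; generalize a; clear; octC).
  assert (Hd : CpartO d = C0) by (unfold d; rewrite CpartO_add, CpartO_scale, Hv, Hp; ring).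
  assert (Od : herm p d = C0).
  { unfold d; rewrite herm_add_r, herm_scale_r, herm_self, Np; fold C1; fold a; ring. }
  destruct (Req_dec (sqnorm d) 0) as [Z|Z].
  - apply sqnorm_eq0 in Z; destruct (cframe_perp Hp Np) as [u F].
    exists u, a, C0; split; [assumption|].
    assert (E : v = Oadd (Omul p (ofC a)) (Omul u (ofC C0))) by (rewrite Ev, Z; clear; octC).
    eauto.
  - assert (Nd : d <> O0) by (intros E; apply Z; rewrite E; clear; oct).
    destruct (normalize Nd) as [r [Hr Nr]].
    assert (F : cframe p (Omul d (ofR r))).
    { change (ofR r) with (ofC (mkC r 0)) in *; split; auto.
      - rewrite CpartO_scale, Hd; ring.
      - rewrite herm_scale_r, Od; ring. }
    exists (Omul d (ofR r)), a, (mkC (/ r) 0); split; [assumption|].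
    assert (E : v = Oadd (Omul p (ofC a)) (Omul (Omul d (ofR r)) (ofC (mkC (/ r) 0)))).
    { change (ofC (mkC (/ r) 0)) with (ofR (/ r)).
      rewrite Omul_ofR, Rinv_r by assumption; change (ofR 1) with O1; now rewrite Omul_1_r. }
    eauto.
Qed.

(** An Euler angle argument. Write h p = p a + u b with [u] orthogonal to [p]; [k2] fixes [q] and
    sends [p] to p a + (pq) b, [k1] fixes [p] and sends pq to [u]. Then k1 k2 and [h] agree at [p],
    so they differ by an element fixing [p]. *)
Lemma decomposition p q h : cframe p q -> exists k1 k2 k3,
  h = comp k1 (comp k2 k3) /\ fn k1 p = p /\ fn k2 q = q /\ fn k3 p = p.
Proof.
  intros F; pose proof (fn_cframe h F) as F'.
  destruct (@split_along p (fn h p)) as [u [a [b [Fu [E N]]]]]; try apply F; try apply F'.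
  pose proof (cframe_left F) as Fw; pose proof (cframe_next F) as Gw.
  destruct (CO_plane_exists Fw Fu) as [k1 [E1 E1']].
  assert (G : cframe q (Oadd (Omul p (ofC a)) (Omul (Omul p q) (ofC b)))).
  { apply cframe_comb_r; auto using cframe_sym. }
  destruct (CO_plane_exists (cframe_sym F) G) as [k2 [E2 E2']].
  destruct (inverse_exists k1) as [l1 [I1 J1]], (inverse_exists k2) as [l2 [I2 J2]].
  exists k1, k2, (comp l2 (comp l1 h)); repeat split; auto.
  - rewrite <- (comp_assoc k2), I2, comp_id_l, <- comp_assoc, I1, comp_id_l; reflexivity.
  - rewrite !fn_comp; etransitivity; [apply f_equal, (inverse_fn J1)|exact (inverse_fn J2 E2')].
    now rewrite fn_add, !fn_linear, E1, E1', E.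
Qed.

Lemma Oadd_opp_cancel v w : Oadd v (Oopp w) = O0 -> v = w.
Proof.
  intros E; replace v with (Oadd (Oadd v (Oopp w)) w) by oct; rewrite E; oct.
Qed.

(* If z is a unit orthogonal to x and v = k z, the eigenvalues s and its conjugate satisfy Re s = Re (z|v), and
   v - z s, v minus z times the conjugate of s are eigenvectors unless one of them vanishes. *)
Lemma fixer_diagonal x k : CpartO x = C0 -> sqnorm x = 1 -> fn k x = x ->
  exists y z s, unitC s /\ cframe y z /\ cframe x y /\ cframe x z /\ diagonal k x y z s.
Proof.
  intros Hx Nx Ek; destruct (cframe_perp Hx Nx) as [z Fz].
  set (v := fn k z).
  assert (Fv : cframe x v) by (pose proof (fn_cframe k Fz) as F; now rewrite Ek in F).
  set (c := rform z v).
  assert (Hc : 0 <= 1 - c * c).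
  { pose proof (sqnorm_nonneg (Oadd v (Oopp (Omul z (ofR (rform v z)))))) as P.
    rewrite residual_norm, (rform_sym v z) in P by apply Fz.
    rewrite (cframe_unit2 Fv) in P; exact P. }
  set (d := sqrt (1 - c * c)); assert (Hd : d * d = 1 - c * c) by now apply sqrt_sqrt.
  set (s := mkC c d).
  assert (Us : unitC s).
  { unfold unitC, s, Cmul, Cconj, C1; cbn [c0 c1]; split_eq; lra. }
  assert (Eig : forall t, unitC t -> v = Omul z (ofC t) ->
    exists y z s, unitC s /\ cframe y z /\ cframe x y /\ cframe x z /\ diagonal k x y z s).
  { intros t Ut E; exists z, (Omul x z), t.
    pose proof (cframe_left Fz); pose proof (cframe_next Fz).
    repeat split; auto; try (now apply Fz); try apply H; try apply H0.
    rewrite fn_mul, Ek; fold v; rewrite E.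
    rewrite <- (Omul_1_r x) at 1; change O1 with (ofC C1).
    rewrite pure_mul_orth by apply Fz; f_equal; f_equal; rewrite Cconj_1; ring. }
  set (y1 := Oadd v (Oopp (Omul z (ofC (Cconj s))))).
  set (w1 := Oadd v (Oopp (Omul z (ofC s)))).
  destruct (Req_dec (sqnorm y1) 0) as [Zy|Zy].
  { apply sqnorm_eq0, Oadd_opp_cancel in Zy; apply (Eig (Cconj s)); auto using unitC_conj. }
  destruct (Req_dec (sqnorm w1) 0) as [Zw|Zw].
  { apply sqnorm_eq0, Oadd_opp_cancel in Zw; apply (Eig s); auto. }
  assert (Opp : forall r, Oopp (Omul z (ofC r)) = Omul z (ofC (Copp r))) by (intros r; clear; octC).
  (* The product is s^2 - 2cs + 1, and [s] is a root of this polynomial. *)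
  assert (O : herm y1 w1 = C0).
  { unfold y1, w1; rewrite !Opp, !herm_add_l, !herm_add_r, !herm_scale_l, !herm_scale_r, !herm_self.
    rewrite (cframe_unit2 Fv), (cframe_unit2 Fz), (herm_conj z v).
    assert (Ec : c0 (herm z v) = c) by reflexivity.
    destruct (herm z v) as [e e']; cbn [c0] in Ec; subst e; clear - Hd; unfold s.
    unfold Cmul, Cconj, Copp, Cadd, C0; cbn [c0 c1]; split_eq; lra. }
  assert (P : forall r, let y := Oadd v (Oopp (Omul z (ofC r))) in CpartO y = C0 /\ herm x y = C0).
  { intros r; cbv zeta; rewrite Opp, CpartO_add, CpartO_scale, herm_add_r, herm_scale_r.
    destruct Fv as [_ -> _ _ ->], Fz as [_ -> _ _ ->]; split; ring. }
  assert (Ny : y1 <> O0) by (intros E; apply Zy; rewrite E; clear; oct).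
  assert (Nw : w1 <> O0) by (intros E; apply Zw; rewrite E; clear; oct).
  destruct (normalize Ny) as [r [Hr Nr]], (normalize Nw) as [r' [Hr' Nr']].
  change (ofR r) with (ofC (mkC r 0)) in Nr; change (ofR r') with (ofC (mkC r' 0)) in Nr'.
  destruct (P (Cconj s)) as [Py Oy], (P s) as [Pw Ow]; fold y1 in Py, Oy; fold w1 in Pw, Ow.
  set (y := Omul y1 (ofC (mkC r 0))) in *; set (w := Omul w1 (ofC (mkC r' 0))) in *.
  assert (Hy : CpartO y = C0) by (unfold y; rewrite CpartO_scale, Py; ring).
  assert (Hw : CpartO w = C0) by (unfold w; rewrite CpartO_scale, Pw; ring).
  assert (Fyw : cframe y w).
  { split; auto; unfold y, w; rewrite herm_scale_l, herm_scale_r, O; ring. }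
  assert (Fxy : cframe x y) by (split; auto; unfold y; rewrite herm_scale_r, Oy; ring).
  assert (Fxw : cframe x w) by (split; auto; unfold w; rewrite herm_scale_r, Ow; ring).
  destruct (diagonal_exists Fyw Fxy Fxw Us) as [t Dt].
  (* Both fix [x], so they are compared at [z], using z(s - conj s) = y1 - w1. Here [s] is not real,
     since otherwise y1 = w1 would be orthogonal to itself. *)
  replace k with t; [now exists y, w, s|].
  destruct Dt as [Tx [Ty Tw]].
  assert (Inv : forall a b e, e <> 0 -> Omul (fn t a) (ofC (mkC e 0)) = Omul (Omul a (ofC (mkC e 0))) (ofC b) ->
    fn t a = Omul a (ofC b)).
  { intros a b e He E; apply (f_equal (fun o => Omul o (ofC (mkC (/ e) 0)))) in E.
    rewrite !Omul_CC in E.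
    replace (Cmul (mkC e 0) (mkC (/ e) 0)) with C1 in E
      by (unfold Cmul, C1; cbn [c0 c1]; split_eq; field; assumption).
    change (ofC C1) with O1 in E; rewrite Omul_1_r in E; rewrite E; f_equal; f_equal.
    unfold Cmul; destruct b as [b b']; cbn [c0 c1]; split_eq; field; assumption. }
  unfold y in Ty; rewrite fn_linear in Ty; apply (Inv _ _ _ Hr) in Ty.
  unfold w in Tw; rewrite fn_linear in Tw; apply (Inv _ _ _ Hr') in Tw.
  apply plane_ext_frame with (1 := Fz); [congruence|]; fold v.
  assert (Nd : d <> 0).
  { intros Z; apply Zy, sqnorm_herm.
    assert (Es : Cconj s = s) by (unfold s, Cconj; cbn [c0 c1]; split_eq; lra).
    assert (Ew : w1 = y1) by (unfold w1, y1; now rewrite Es).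
    rewrite Ew in O; exact O. }
  assert (E : Omul (fn t z) (ofC (Csub s (Cconj s))) = Omul v (ofC (Csub s (Cconj s)))).
  { rewrite <- fn_linear.
    replace (Omul z (ofC (Csub s (Cconj s)))) with (Oadd y1 (Oopp w1))
      by (unfold y1, w1; generalize v s; clear; octC).
    replace (Oopp w1) with (Omul w1 (ofC (Copp C1))) by (generalize w1; clear; octC).
    rewrite fn_add, fn_linear, Ty, Tw; unfold y1, w1.
    transitivity (Oadd (Omul v (ofC (Csub s (Cconj s))))
      (Omul z (ofC (Csub (Cmul s (Cconj s)) (Cmul (Cconj s) s))))).
    - generalize v s; clear; octC.
    - generalize v s; clear; octC. }
  (* The factor is the inverse of s - conj s = 2di. *)
  apply (f_equal (fun o => Omul o (ofC (mkC 0 (- / (2 * d)))))) in E; rewrite !Omul_CC in E.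
  replace (Cmul (Csub s (Cconj s)) (mkC 0 (- / (2 * d)))) with C1 in E.
  - change (ofC C1) with O1 in E; now rewrite !Omul_1_r in E.
  - unfold s, Cmul, Csub, Cconj, Cadd, Copp, C1; cbn [c0 c1]; split_eq; field; assumption.
Qed.

(** The root is (1 + s)/|1 + s|, where |1 + s|^2 = 2 + 2a; for s = -1 it is i. *)
Lemma unit_sqrt s : unitC s -> exists r, unitC r /\ Cmul r r = s.
Proof.
  destruct s as [a b]; unfold unitC, Cmul, Cconj, C1; cbn [c0 c1]; intros H.
  apply (f_equal c0) in H; cbn [c0] in H.
  destruct (Req_dec a (-1)) as [->|Ha].
  - exists (mkC 0 1); cbn [c0 c1]; split; split_eq; nra.
  - assert (P : 0 < 2 + 2 * a) by nra.
    set (m := / sqrt (2 + 2 * a)).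
    assert (Hm : m * m * (2 + 2 * a) = 1).
    { unfold m; pose proof (sqrt_lt_R0 _ P) as S.
      rewrite <- (sqrt_sqrt (2 + 2 * a)) at 3 by lra; field; lra. }
    exists (mkC ((1 + a) * m) (b * m)); cbn [c0 c1]; split; split_eq.
    + transitivity ((1 + 2 * a + (a * a + b * b)) * (m * m)); [ring|].
      replace (a * a + b * b) with 1 by lra.
      transitivity (m * m * (2 + 2 * a)); [ring|exact Hm].
    + ring.
    + transitivity ((2 * a * (1 + a) + (1 - (a * a + b * b))) * (m * m)); [ring|].
      replace (a * a + b * b) with 1 by lra.
      transitivity (a * (m * m * (2 + 2 * a))); [ring|rewrite Hm; ring].
    + transitivity (b * (m * m * (2 + 2 * a))); [ring|rewrite Hm; ring].
Qed.
End Structure.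

(** * Words of translations over the complex numbers *)

(* The letter (P, h) stands for the paths f - P - f h, where f is any plane. *)
Definition word := list (point CO * plane CO).

Fixpoint word_end (w : word) (f : plane CO) : plane CO :=
  match w with [] => f | (_, h) :: w => word_end w (comp f h) end.

Fixpoint word_path (w : word) (f : plane CO) : list (gelt CO) :=
  match w with [] => [] | (P, h) :: w => Pt P :: Pl (comp f h) :: word_path w (comp f h) end.

(** Equal ends allow the words to be continued alike; quantifying over the start allows them to be
    preceded alike. *)
Definition word_eq (w w' : word) : Prop :=
  (forall f, word_end w f = word_end w' f) /\
  (forall f, path_eq (Pl f :: word_path w f) (Pl f :: word_path w' f)).
Local Notation "w == w'" := (word_eq w w') (at level 70).

#[global] Instance word_eq_equivalence : Equivalence word_eq.
Proof.
  split.
  - now split.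
  - intros w w' [H H']; split; now symmetry.
  - intros w v u [H H'] [K K']; split; etransitivity; eauto.
Qed.

Lemma word_end_app w v f : word_end (w ++ v) f = word_end v (word_end w f).
Proof. revert f; induction w as [|[P h] w IH]; intros f; [reflexivity|apply IH]. Qed.

Lemma word_path_app w v f : word_path (w ++ v) f = word_path w f ++ word_path v (word_end w f).
Proof.
  revert f; induction w as [|[P h] w IH]; intros f; [reflexivity|].
  cbn [word_path app]; now rewrite IH.
Qed.

Lemma word_path_last w f : exists l, Pl f :: word_path w f = l ++ [Pl (word_end w f)].
Proof.
  revert f; induction w as [|[P h] w IH]; intros f; [now exists []|].
  destruct (IH (comp f h)) as [l E]; exists (Pl f :: Pt P :: l).
  cbn [word_path app word_end]; now rewrite E.
Qed.

#[global] Instance app_word_eq : Proper (word_eq ==> word_eq ==> word_eq) (@app _).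
Proof.
  intros w w' [H H'] v v' [K K']; split; intros f; [rewrite !word_end_app, H; apply K|].
  rewrite !word_path_app, !app_comm_cons, H', H.
  destruct (word_path_last w' f) as [l ->]; rewrite <- !app_assoc; cbn [app].
  now rewrite K'.
Qed.

#[global] Instance cons_word_eq : Proper (eq ==> word_eq ==> word_eq) cons.
Proof. intros a _ <- w w' H; exact (app_word_eq (reflexivity [a]) H). Qed.

(** With [word_id]: for a fixed point P, the letters (P, h) form the homomorphism i_P. *)
Lemma word_mul P h k w : (P, h) :: (P, k) :: w == (P, comp h k) :: w.
Proof.
  apply (@app_word_eq [(P, h); (P, k)] [(P, comp h k)]); [|reflexivity].
  split; intros f; cbn [word_end word_path]; rewrite comp_assoc; [reflexivity|].
  now rewrite (@backtrack CO (Pt P) (Pl (comp f h))) by apply adj_pt_pl.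
Qed.

Lemma word_id P w : (P, idp) :: w == w.
Proof.
  apply (@app_word_eq [(P, idp)] []); [|reflexivity].
  split; intros f; cbn [word_end word_path]; rewrite comp_id_r; [reflexivity|].
  apply backtrack, adj_pl_pt.
Qed.

(** The planes [f] and [comp f h] agree at [x], the pole of the two points, so their square
    bounds. *)
Lemma word_agree P Q p q x h w : represents P p -> represents Q q ->
  cframe x p -> cframe x q -> fn h x = x -> (P, h) :: w == (Q, h) :: w.
Proof.
  intros HP HQ Fp Fq E.
  apply (@app_word_eq [(P, h)] [(Q, h)]); [|reflexivity].
  split; intros f; [reflexivity|]; cbn [word_path].
  apply square_agree with (x := x) (p := p) (q := q); auto.
  - apply inPu_CO; split; [exact I|apply Fp].
  - apply Fp.
  - apply form_CO0, Fp.
  - apply form_CO0, Fq.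
  - now rewrite fn_comp, E.
Qed.

(** Any plane [g] is the translate of [f] by the inverse of [f] composed with [g]. *)
Lemma square_of_word P Q : (forall h, [(P, h)] == [(Q, h)]) -> forall f g, square P Q f g.
Proof.
  intros H f g; destruct (inverse_exists f) as [f' [E _]].
  destruct (H (comp f' g)) as [_ K]; specialize (K f); cbn [word_path] in K.
  rewrite <- comp_assoc, E, comp_id_l in K; exact K.
Qed.

(** * What the defect (Y, t) (X, t') of a diagonal element commutes with *)

Section Axes.
Variables (X Y Z : point CO) (x y z : Oc) (t t' : plane CO) (s : Cx).
Hypotheses (HX : represents X x) (HY : represents Y y) (HZ : represents Z z).
Hypotheses (Fxy : cframe x y) (Fxz : cframe x z) (Fyz : cframe y z).
Hypotheses (I1 : comp t t' = idp) (I2 : comp t' t = idp).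

(* Conjugation by t permutes the elements fixing [y], on which the translations through X and Z agree. *)
Lemma defect_commutes_axis k c : fn t x = x -> fn t y = Omul y (ofC c) -> fn k y = y ->
  [(Y, t); (X, t'); (X, k)] == [(X, k); (Y, t); (X, t')].
Proof.
  intros Ex Ey Ek; set (k1 := comp t' (comp k t)).
  assert (E1 : fn k1 y = y).
  { unfold k1; rewrite !fn_comp, Ey, fn_linear, Ek, <- Ey; now apply (inverse_fn I2). }
  assert (A : forall w, (Y, t) :: w == (Z, t) :: w) by (intros w; exact (word_agree w HY HZ Fxy Fxz Ex)).
  assert (B : forall h w, fn h y = y -> (X, h) :: w == (Z, h) :: w).
  { intros h w; exact (word_agree w HX HZ (cframe_sym Fxy) Fyz). }
  rewrite word_mul, (A _).
  replace (comp t' k) with (comp k1 t')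
    by (unfold k1; now rewrite !comp_assoc, I1, comp_id_r).
  rewrite <- word_mul, (B k1), word_mul by assumption.
  replace (comp t k1) with (comp k t)
    by (unfold k1; now rewrite <- !comp_assoc, I1, comp_id_l).
  now rewrite <- word_mul, (B k), (A _) by assumption.
Qed.

Lemma defect_commutes_comp h k :
  [(Y, t); (X, t'); (X, h)] == [(X, h); (Y, t); (X, t')] ->
  [(Y, t); (X, t'); (X, k)] == [(X, k); (Y, t); (X, t')] ->
  [(Y, t); (X, t'); (X, comp h k)] == [(X, comp h k); (Y, t); (X, t')].
Proof.
  intros Eh Ek; rewrite <- !word_mul.
  rewrite <- Ek; exact (app_word_eq Eh (reflexivity [(X, k)])).
Qed.
End Axes.

Section Defect.
Variables (X Y Z : point CO) (x y z : Oc) (t t' : plane CO) (s : Cx).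
Hypotheses (HX : represents X x) (HY : represents Y y) (HZ : represents Z z).
Hypotheses (Fxy : cframe x y) (Fxz : cframe x z) (Fyz : cframe y z).
Hypotheses (I1 : comp t t' = idp) (I2 : comp t' t = idp).
Hypotheses (Us : unitC s) (Dt : diagonal t x y z s).

(** Elements fixing [y] or [z] generate the group. For those fixing [z], exchange [Y] and [Z]; this
    leaves the defect unchanged because [t] fixes [x]. *)
Lemma defect_commutes k : [(Y, t); (X, t'); (X, k)] == [(X, k); (Y, t); (X, t')].
Proof.
  destruct Dt as [Ex [Ey Ez]].
  destruct (decomposition k Fyz) as [k1 [k2 [k3 [-> [E1 [E2 E3]]]]]].
  repeat apply defect_commutes_comp;
    [apply (defect_commutes_axis HX HY HZ) with (c := s); assumption|
     |apply (defect_commutes_axis HX HY HZ) with (c := s); assumption].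
  pose proof (defect_commutes_axis HX HZ HY Fxz Fxy (cframe_sym Fyz) I1 I2 Ex Ez E2) as H.
  rewrite (word_agree _ HZ HY Fxz Fxy Ex) in H.
  rewrite H; apply cons_word_eq; [reflexivity|].
  exact (word_agree _ HZ HY Fxz Fxy Ex).
Qed.

(** The inverse of [t] is t2 t3 with [t2] diagonal fixing [y] and [t3] diagonal fixing [z], so (X,
    t') = (Z, t2) (Y, t3) and the defect is a word in [Y] and [Z]. Moving [k] leftwards conjugates
    it by [t3], then by [t2]; the results still fix [x], where translations through [Y] and [Z]
    agree. In all, [k] is conjugated by t t2 t3 = 1. *)
Lemma defect_commutes_fixer k : fn k x = x ->
  [(Y, t); (X, t'); (Y, k)] == [(Y, k); (Y, t); (X, t')].
Proof.
  intros Ek; destruct Dt as [Ex [Ey Ez]].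
  assert (Fyx := cframe_sym Fxy); assert (Fzx := cframe_sym Fxz); assert (Fzy := cframe_sym Fyz).
  destruct (diagonal_exists Fxz Fyx Fyz (unitC_conj Us)) as [t2 [E2y [E2x E2z]]].
  destruct (diagonal_exists Fxy Fzx Fzy Us) as [t3 [E3z [E3x E3y]]].
  rewrite Cconj_involutive in E2z.
  assert (U : Cmul (Cconj s) s = C1) by exact Us.
  assert (U' : Cmul s (Cconj s) = C1) by now apply unitC_conj_r.
  assert (T : comp t (comp t2 t3) = idp).
  { apply plane_ext_frame with (1 := Fxy); rewrite !fn_comp, fn_idp.
    - rewrite E3x, fn_linear, E2x, Omul_CC, U, fn_linear, Ex; apply Omul_1_r.
    - rewrite E3y, !fn_linear, E2y, Ey, Omul_CC, U'; apply Omul_1_r. }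
  assert (T' : t' = comp t2 t3).
  { now rewrite <- (comp_id_r t'), <- T, <- comp_assoc, I2, comp_id_l. }
  destruct (inverse_exists t2) as [u2 [J2 K2]], (inverse_exists t3) as [u3 [J3 K3]].
  set (k3 := comp t3 (comp k u3)); set (k2 := comp t2 (comp k3 u2)).
  assert (Fk3 : fn k3 x = x).
  { unfold k3; rewrite !fn_comp.
    assert (E : fn u3 x = Omul x (ofC (Cconj s))).
    { apply (inverse_fn K3); rewrite fn_linear, E3x, Omul_CC, U'; apply Omul_1_r. }
    rewrite E, !fn_linear, Ek, E3x, Omul_CC, U'; apply Omul_1_r. }
  assert (Fk2 : fn k2 x = x).
  { unfold k2; rewrite !fn_comp.
    assert (E : fn u2 x = Omul x (ofC s)).
    { apply (inverse_fn K2); rewrite fn_linear, E2x, Omul_CC, U; apply Omul_1_r. }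
    rewrite E, !fn_linear, Fk3, E2x, Omul_CC, U; apply Omul_1_r. }
  assert (A : forall h w, fn h x = x -> (Y, h) :: w == (Z, h) :: w).
  { intros h w; exact (word_agree w HY HZ Fxy Fxz). }
  assert (B : forall w, (X, t') :: w == (Z, t2) :: (Y, t3) :: w).
  { intros w; rewrite T', <- word_mul, (word_agree _ HX HZ Fyx Fyz E2y).
    now rewrite (word_agree _ HX HY Fzx Fzy E3z). }
  rewrite (B [(Y, k)]), word_mul.
  replace (comp t3 k) with (comp k3 t3) by (unfold k3; now rewrite !comp_assoc, K3, comp_id_r).
  rewrite <- word_mul, (A k3), word_mul by assumption.
  replace (comp t2 k3) with (comp k2 t2) by (unfold k2; now rewrite !comp_assoc, K2, comp_id_r).
  rewrite <- word_mul, <- (A k2), word_mul by assumption.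
  replace (comp t k2) with (comp k t); [now rewrite (B []), <- word_mul|].
  assert (E : comp t (comp t2 (comp t3 (comp k (comp u3 u2)))) = comp k (comp u3 u2)).
  { rewrite <- (comp_assoc t2), <- comp_assoc, T; apply comp_id_l. }
  unfold k2, k3; rewrite !comp_assoc, E; f_equal.
  rewrite <- (comp_id_l (comp u3 u2)), <- T, !comp_assoc.
  now rewrite <- (comp_assoc t3 u3), J3, comp_id_l, J2, comp_id_r.
Qed.
End Defect.

(** * Translations through orthogonal points agree on a stabilizer *)

Section Fixers.
Variables (X S : point CO) (x r : Oc).
Hypotheses (HX : represents X x) (HS : represents S r) (F : cframe x r).

(** Choose an eigenframe x, y, z of [a]. On elements fixing [x], translations through [S] and [y]
    agree, both points being orthogonal to [x]. *)
Lemma fixer_defect a a' : fn a x = x -> comp a a' = idp -> comp a' a = idp ->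
  (forall k, [(S, a); (X, a'); (X, k)] == [(X, k); (S, a); (X, a')]) /\
  (forall k, fn k x = x -> [(S, a); (X, a'); (S, k)] == [(S, k); (S, a); (X, a')]).
Proof.
  intros Ea I1 I2.
  destruct (@fixer_diagonal x a) as [y [z [s [Us [Fyz [Fxy [Fxz D]]]]]]]; try apply F; auto.
  destruct (@point_exists CO y) as [Y HY];
    [apply inPu_CO; split; [exact I|apply Fxy]|apply Fxy|].
  destruct (@point_exists CO z) as [Z HZ];
    [apply inPu_CO; split; [exact I|apply Fxz]|apply Fxz|].
  assert (A : forall h w, fn h x = x -> (S, h) :: w == (Y, h) :: w).
  { intros h w; exact (word_agree w HS HY F Fxy). }
  split.
  - intros k; rewrite !(A a) by assumption.
    exact (defect_commutes HX HY HZ Fxy Fxz Fyz I1 I2 D k).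
  - intros k Ek; rewrite !(A a), !(A k) by assumption.
    exact (defect_commutes_fixer HX HY HZ Fxy Fxz Fyz I2 Us D Ek).
Qed.

(* Two commuting relations for the defects evaluate (X, a') (S, b) (X, a) in two ways. *)
Lemma fixer_commutator a a' b b' : fn a x = x -> fn b x = x ->
  comp a a' = idp -> comp a' a = idp -> comp b b' = idp -> comp b' b = idp ->
  let c := comp b' (comp a' (comp b a)) in [(S, c)] == [(X, c)].
Proof.
  intros Ea Eb Ia Ia' Ib Ib'; cbv zeta.
  destruct (fixer_defect Ea Ia Ia') as [_ Ha], (fixer_defect Eb Ib Ib') as [Hb _].
  specialize (Ha b Eb); specialize (Hb a').
  assert (E1 : [(X, a'); (S, b); (X, a)] == [(S, comp a' (comp b a))]).
  { rewrite <- (word_id S), <- Ia', <- word_mul.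
    transitivity ([(S, a')] ++ [(S, a); (X, a'); (S, b)] ++ [(X, a)]); [reflexivity|].
    rewrite Ha; cbn [app]; rewrite word_mul, (word_mul X), Ia', (word_id X), word_mul.
    now rewrite comp_assoc. }
  assert (E2 : [(X, a'); (S, b); (X, a)] == [(S, b); (X, comp b' (comp a' (comp b a)))]).
  { transitivity ([(X, a'); (S, b); (X, b')] ++ [(X, b); (X, a)]).
    - cbn [app]; now rewrite (word_mul X b' b), Ib', (word_id X).
    - rewrite <- Hb; cbn [app]; now rewrite !word_mul, !comp_assoc. }
  rewrite <- (word_id S [(X, _)]), <- Ib', <- (word_mul S b' b), <- E2, E1.
  now rewrite word_mul.
Qed.

(** Every such [h] is a commutator: if b' is the diagonal square root of [h] and [a] the quarter
    turn in the same eigenframe, then [a] conjugates the inverse of b' into b', so b' a' b a = b' b'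
    = h. *)
Lemma fixer_agree h : fn h x = x -> [(S, h)] == [(X, h)].
Proof.
  intros Eh.
  destruct (@fixer_diagonal x h) as [y [z [s [Us [Fyz [Fxy [Fxz D]]]]]]]; try apply F; auto.
  destruct (unit_sqrt Us) as [c [Uc Ec]].
  destruct (diagonal_exists Fyz Fxy Fxz Uc) as [b' [Bx [By Bz]]].
  destruct (quarter_turn Fyz Fxy Fxz) as [a [Ax [Ay Az]]].
  destruct (inverse_exists a) as [a' [Ia Ia']], (inverse_exists b') as [b [Ib' Ib]].
  assert (E : h = comp b' (comp a' (comp b a))).
  { destruct D as [_ [Dy Dz]].
    assert (U : Cmul (Cconj c) c = C1) by exact Uc.
    assert (Gy : fn b y = Omul y (ofC (Cconj c))).
    { apply (inverse_fn Ib); rewrite fn_linear, By, Omul_CC, (unitC_conj_r Uc); apply Omul_1_r. }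
    assert (Gz : fn b z = Omul z (ofC c)).
    { apply (inverse_fn Ib); rewrite fn_linear, Bz, Omul_CC, U; apply Omul_1_r. }
    assert (Hz : fn a' z = y) by exact (inverse_fn Ia' Ay).
    assert (Hy : fn a' y = Omul z (ofC (Copp C1))).
    { apply (inverse_fn Ia'); rewrite fn_linear, Az, Omul_CC.
      replace (Cmul (Copp C1) (Copp C1)) with C1 by ring; apply Omul_1_r. }
    apply plane_ext_frame with (1 := Fyz); rewrite !fn_comp.
    - rewrite Dy, Ay, Gz, fn_linear, Hz, fn_linear, By, Omul_CC, Ec; reflexivity.
    - rewrite Dz, Az, fn_linear, Gy, Omul_CC, fn_linear, Hy, Omul_CC, fn_linear, Bz, Omul_CC.
      rewrite <- Ec, Cconj_mul; f_equal; f_equal; ring. }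
  rewrite E; apply fixer_commutator; auto.
  apply (inverse_fn Ib), Bx.
Qed.
End Fixers.

Lemma CO_square_orth (P Q : point CO) p q f g :
  represents P p -> represents Q q -> form CO p q = O0 -> square P Q f g.
Proof.
  intros HP HQ H.
  assert (F : cframe p q).
  { destruct HP as [Hp [Np _]], HQ as [Hq [Nq _]]; apply (frame_CO (inA CO)); now split. }
  apply square_of_word; intros h.
  destruct (decomposition h F) as [k1 [k2 [k3 [-> [E1 [E2 E3]]]]]].
  rewrite <- !word_mul.
  pose proof (fixer_agree HP HQ F) as A; pose proof (fixer_agree HQ HP (cframe_sym F) E2) as B.
  apply (@app_word_eq [_] [_]); [symmetry; now apply A|].
  apply (@app_word_eq [_] [_]); [exact B|symmetry; now apply A].
Qed.

Lemma simply_connected_CO : simply_connected (Gamma CO).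
Proof.
  apply Gamma_simply_connected with (e := e_j).
  - exact CO_frame_extend.
  - exact CO_frame_product.
  - intros x y a b H H'; apply frame_CO in H as [_ [_ H]], H' as [_ [_ H']].
    now apply CO_plane_exists.
  - exact CO_square_orth.
  - apply inPu_CO; split; [exact I|reflexivity].
  - unfold e_j; unfold_oct; ring.
Qed.

Theorem theorem1p5 : simply_connected (Gamma RH) /\ simply_connected (Gamma CO).
Proof. exact (conj simply_connected_RH simply_connected_CO). Qed.
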